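(* Let $t \geq 2$ and $1 \leq k_1 \leq \cdots \leq k_t$ be integers with $n = k_1 + \cdots + k_t \geq 4$, let $K_{k_1,\ldots,k_t}$ have vertex set $[n]$, and let $X$ be a graph on $n$ vertices. Suppose one of the following holds: \begin{enumerate} \item $t = 2$ and $k_t < n-1$, and $X$ is connected, is non-bipartite, is not a cycle, and does not contain a $k_1$-bridge; \item $t > 2$, and $X$ is connected, is not a cycle, is not a tree, and does not contain an $(n-k_t)$-bridge. \end{enumerate} Then for any $i, j \in [n]$ and any bijection $\sigma: V(X) \to [n]$ with $\{\sigma^{-1}(i), \sigma^{-1}(j)\} \in E(X)$, the vertices $i$ and $j$ are $(X, K_{k_1,\ldots,k_t})$-exchangeable from $\sigma$.
   Context: All graphs are simple. For graphs $X, Y$ on $n$ vertices, the friends-and-strangers graph $\mathsf{FS}(X,Y)$ has as vertices all bijections $\sigma: V(X) \to V(Y)$; two bijections $\sigma, \sigma'$ are adjacent iff there is an edge $\{a,b\} \in E(X)$ with $\{\sigma(a),\sigma(b)\} \in E(Y)$, $\sigma'(a) = \sigma(b)$, $\sigma'(b) = \sigma(a)$, and $\sigma'(c) = \sigma(c)$ for all other $c$ (an $(X,Y)$-friendly swap). For a bijection $\sigma: V(X) \to V(Y)$ and $u, v \in V(Y)$, $u$ and $v$ are $(X,Y)$-exchangeable from $\sigma$ if some sequence of $(X,Y)$-friendly swaps takes $\sigma$ to $(u\; v)\circ\sigma$. $K_{k_1,\ldots,k_t}$ denotes the complete $t$-partite graph with partition classes of sizes $k_1,\ldots,k_t$. A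 path $v_1, \ldots, v_k$ in a graph is a $k$-bridge if each edge of the path is a cut-edge, $v_2,\ldots,v_{k-1}$ have degree $2$, and $v_1, v_k$ do not have degree $1$; a single cut-vertex is a $1$-bridge. *)

(* Defs.v *)
From mathcomp Require Import all_boot all_fingroup.

Set Implicit Arguments.
Unset Strict Implicit.
Unset Printing Implicit Defensive.

Record sgraph (V : finType) := SGraph {
  edge :> rel V;
  edge_sym : symmetric edge;
  edge_irr : irreflexive edge
}.

Section Graphs.

Variables (V : finType) (X : sgraph V).

Definition deg (v : V) : nat := #|[set w | X v w]|.

Definition connected : Prop := forall u v : V, connect X u v.

Definition bipartite : Prop :=
  exists c : V -> bool, forall u v, X u v -> c u != c v.

(* The whole graph is a cycle, listed by s in cyclic order. *)
Definition is_cycle : Prop :=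
  exists s : seq V,
    [/\ uniq s, 2 < size s, forall v, v \in s
      & forall u v, X u v = (v == next s u) || (u == next s v)].

(* ucycle also holds of a single edge listed as [:: u; v], hence the bound on the size. *)
Definition acyclic : Prop :=
  forall s : seq V, 2 < size s -> ~ ucycle X s.

Definition is_tree : Prop := connected /\ acyclic.

Definition del_edge (a b : V) : rel V :=
  fun u v => [&& X u v, (u, v) != (a, b) & (u, v) != (b, a)].

Definition del_vertex (a : V) : rel V :=
  fun u v => [&& X u v, u != a & v != a].

Definition cut_edge (a b : V) : bool :=
  X a b && (n_comp X V < n_comp (del_edge a b) V).

(* In [del_vertex v] the vertex v is isolated; components are counted on the
   remaining vertices only. *)
Definition cut_vertex (v : V) : bool :=
  n_comp X V < n_comp (del_vertex v) (predC1 v).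

(* The first disjunct is k = 1; the path v1, s, vk has at least two vertices. *)
Definition has_bridge (k : nat) : Prop :=
  (k = 1 /\ exists v, cut_vertex v) \/
  (exists v1 s vk, let p := v1 :: rcons s vk in
     [/\ size p = k, uniq p, sorted cut_edge p,
         (forall v, v \in s -> deg v = 2)
       & deg v1 <> 1 /\ deg vk <> 1]).

(* The i-th class is the fibre of c over i. *)
Definition complete_multipartite (t : nat) (k : t.-tuple nat) : Prop :=
  exists c : V -> 'I_t,
    (forall i, #|[set v | c v == i]| = tnth k i) /\
    (forall u v, X u v = (c u != c v)).

End Graphs.

Section FriendsAndStrangers.

Variables V W : finType.

Definition bijb (f : {ffun V -> W}) : bool :=
  injectiveb f && [forall w, exists v, f v == w].

Lemma bijbP (f : {ffun V -> W}) : reflect (bijective f) (bijb f).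
Proof.
apply: (iffP andP) => [[/injectiveP fI /forallP fS]|fB].
  have fE w : {v | f v == w} by apply: sigW; apply/existsP.
  exists (fun w => sval (fE w)) => [v|w]; last exact/eqP/(svalP (fE w)).
  by apply: fI; apply/eqP/(svalP (fE (f v))).
split; first exact/injectiveP/bij_inj.
by case: fB => g _ gK; apply/forallP=> w; apply/existsP; exists (g w); rewrite gK.
Qed.

Definition bijection := {f : {ffun V -> W} | bijb f}.

Definition bij_fun (s : bijection) : V -> W := val s.
Coercion bij_fun : bijection >-> Funclass.

Lemma bij_bij (s : bijection) : bijective s.
Proof. exact/bijbP/(valP s). Qed.

Lemma bij_codom (s : bijection) (w : W) : w \in codom s.
Proof. by have [g _ gK] := bij_bij s; rewrite -[w]gK codom_f. Qed.

Definition bij_inv (s : bijection) (w : W) : V := iinv (bij_codom s w).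

Lemma bij_invK (s : bijection) : cancel (bij_inv s) s.
Proof. by move=> w; exact: f_iinv. Qed.

Lemma bijK (s : bijection) : cancel s (bij_inv s).
Proof. by move=> v; apply: (bij_inj (bij_bij s)); rewrite bij_invK. Qed.

Lemma bijb_tperm (u v : W) (s : bijection) :
  bijb [ffun x => tperm u v (s x)].
Proof.
apply/bijbP; apply: (@eq_bij _ _ (tperm u v \o s)).
  apply: bij_comp (bij_bij s); exact: (Bijective (tpermK u v) (tpermK u v)).
by move=> x; rewrite ffunE.
Qed.

Definition transpose_after (u v : W) (s : bijection) : bijection :=
  exist (fun f => bijb f) _ (bijb_tperm u v s).

Variables (X : sgraph V) (Y : sgraph W).

Definition friendly_swap : rel bijection := fun s s' =>
  [exists a, exists b,
    [&& X a b, Y (s a) (s b), s' a == s b, s' b == s a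
      & [forall c, (c != a) ==> (c != b) ==> (s' c == s c)]]].

Lemma friendly_swap_sym : symmetric friendly_swap.
Proof.
suff sub s s' : friendly_swap s s' -> friendly_swap s' s.
  by move=> s s'; apply/idP/idP; exact: sub.
case/existsP=> a /existsP[b /and5P[Xab Yab /eqP sa /eqP sb /forallP sc]].
apply/existsP; exists a; apply/existsP; exists b.
rewrite Xab sa sb edge_sym Yab !eqxx /=.
apply/forallP=> c; apply/implyP=> ca; apply/implyP=> cb.
by rewrite eq_sym; move: (sc c); rewrite ca cb.
Qed.

Lemma friendly_swap_irr : irreflexive friendly_swap.
Proof.
move=> s; apply/negbTE/negP; case/existsP=> a /existsP[b /and5P[_ Yab /eqP sa _ _]].
by rewrite sa edge_irr in Yab.
Qed.

Definition FS : sgraph bijection := SGraph friendly_swap_sym friendly_swap_irr.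

Definition exchangeable (s : bijection) (u v : W) : Prop :=
  connect FS s (transpose_after u v s).

End FriendsAndStrangers.

(* Main.v *)
Require Import Defs.
From mathcomp Require Import all_boot all_fingroup zify.
From Stdlib Require Import Classical.

Set Implicit Arguments.
Unset Strict Implicit.
Unset Printing Implicit Defensive.

(* Only tokens i, j of the same class matter.  Call their class black and all
   other tokens white, so that a black and a white token on adjacent vertices can
   always be swapped, and let m be the length of the forbidden bridges; there are
   at least m >= 2 white tokens.

   Exchangeability from s is invariant under moves and is an equivalence on the
   black tokens.  X has a vertex v of degree at least 3.  Say that a connected set
   T of vertices is good if, whenever T holds all the white tokens or at most two
   black ones, the black tokens in T are pairwise exchangeable.  A good T
   containing a claw at v grows to all of X: a token on a neighbour u of T can be
   brought into T through a path of fewer than m vertices ending at a vertex with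
   two further neighbours in T, and an ear of T can be rotated through T.  If
   neither extension exists, walking back from the boundary of T gives an m-bridge.

   With at least three classes the claw itself is good: bring two white tokens of
   distinct classes into it next to i and j; then a leaf of the claw can be
   exchanged with another one by three swaps through v.  With two
   classes a claw only yields (i j)(k l) with k, l white, so the growth argument
   is run for both classes with "exchangeable up to an odd permutation of the other
   class".  As X is not bipartite, some closed walk of colour patterns has an odd
   number of swaps; correcting it on the black tokens gives an odd permutation of
   the white tokens alone.  Such permutations form a normal subgroup of the
   symmetric group on the white tokens, which must then be everything. *)

(** * Moves and colour patterns *)

Section Bijections.

Variables V P : finType.
Implicit Types (s : bijection V P) (g h : {perm P}).

Lemma bij_ext s s' : s =1 s' -> s = s'.
Proof. by move=> ss; apply/val_inj/ffunP. Qed.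

Lemma bijI s : injective s.
Proof. exact/bij_inj/bij_bij. Qed.

Lemma bijb_pact g s : bijb [ffun x => g (s x)].
Proof.
apply/bijbP; apply: (@eq_bij _ _ (g \o s)).
  by apply: bij_comp (bij_bij s); exists (g^-1)%g => x; rewrite ?permK ?permKV.
by move=> x; rewrite ffunE.
Qed.

Definition pact g s : bijection V P := exist (fun f => bijb f) _ (bijb_pact g s).

Lemma pactE g s x : pact g s x = g (s x).
Proof. by rewrite /bij_fun /= ffunE. Qed.

Lemma pact1 s : pact 1 s = s.
Proof. by apply: bij_ext => x; rewrite pactE perm1. Qed.

Lemma pactM g h s : pact (g * h) s = pact h (pact g s).
Proof. by apply: bij_ext => x; rewrite !pactE permM. Qed.

Lemma transpose_pact u v s : transpose_after u v s = pact (tperm u v) s.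
Proof. by apply: bij_ext => x; rewrite pactE /bij_fun /= ffunE. Qed.

Definition sw a b s := pact (tperm (s a) (s b)) s.

Lemma swE a b s x : sw a b s x = s (tperm a b x).
Proof. by rewrite pactE inj_tperm //; apply: bijI. Qed.

End Bijections.

Section Moves.

Variables (V P : finType) (X : sgraph V) (Y : sgraph P).
Implicit Types (s : bijection V P) (T D : {set V}).

Lemma connect_sw a b s : X a b -> Y (s a) (s b) -> connect (FS X Y) s (sw a b s).
Proof.
move=> Xab Yab; apply: connect1; apply/existsP; exists a; apply/existsP; exists b.
rewrite Xab Yab !swE tpermL tpermR !eqxx /=.
apply/forallP=> c; apply/implyP=> ca; apply/implyP=> cb.
by rewrite swE tpermD // eq_sym.
Qed.

Lemma FSC : connect_sym (FS X Y).
Proof. exact/sym_connect_sym/edge_sym. Qed.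

(** Only the final configuration has to agree with [s] off [T]; the moves in between may use all of
    [X]. *)
Definition reach T s s' :=
  connect (FS X Y) s s' /\ forall x, x \notin T -> s' x = s x.

Lemma reach_refl T s : reach T s s.
Proof. by []. Qed.

Lemma reach_trans T s1 s2 s3 : reach T s1 s2 -> reach T s2 s3 -> reach T s1 s3.
Proof.
move=> [c12 o12] [c23 o23]; split; first exact: connect_trans c12 c23.
by move=> x xT; rewrite o23 ?o12.
Qed.

Lemma reach_sub T T' s s' : T \subset T' -> reach T s s' -> reach T' s s'.
Proof.
move=> sTT [c o]; split=> // x xT; apply: o.
by apply: contraNN xT; apply: (subsetP sTT).
Qed.

Lemma reach_sw T a b s : a \in T -> b \in T -> X a b -> Y (s a) (s b) ->
  reach T s (sw a b s).
Proof.
move=> aT bT Xab Yab; split=> [|x xT]; first exact: connect_sw.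
rewrite swE tpermD //; first by apply: contraNneq xT => <-.
by apply: contraNneq xT => <-.
Qed.

Lemma reach_pos T s s' x : reach T s s' -> x \in T -> exists2 y, y \in T & s' y = s x.
Proof.
move=> [_ o] xT; exists (bij_inv s' (s x)); last by rewrite bij_invK.
apply: contraT => yT; have := o _ yT; rewrite bij_invK => /bijI xy.
by rewrite -xy xT in yT.
Qed.

Definition inside T : rel V := fun x y => [&& X x y, x \in T & y \in T].

Definition conn T := {in T &, forall a b, connect (inside T) a b}.

Lemma inside_sym T : symmetric (inside T).
Proof. by move=> x y; rewrite /inside edge_sym; congr (_ && _); rewrite andbC. Qed.

Lemma insideC T : connect_sym (inside T).
Proof. exact/sym_connect_sym/inside_sym. Qed.

Lemma inside_sub T T' : T \subset T' -> subrel (inside T) (inside T').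
Proof. by move=> /subsetP sTT x y /and3P[Xxy /sTT ? /sTT ?]; apply/and3P. Qed.

Lemma connect_inside_sub T T' a b :
  T \subset T' -> connect (inside T) a b -> connect (inside T') a b.
Proof.
by move=> sTT; apply: connect_sub => x y /(inside_sub sTT); apply: connect1.
Qed.

Lemma path_inside x p T : path X x p -> {subset x :: p <= T} ->
  connect (inside T) x (last x p).
Proof.
elim: p x => //= y p IH x /andP[Xxy pp] sT.
apply: (@connect_trans _ _ y).
  by apply/connect1/and3P; split=> //; apply: sT; rewrite !inE eqxx ?orbT.
by apply: IH => // z zp; apply: sT; rewrite inE zp orbT.
Qed.

Lemma conn_add T v u : conn T -> v \in T -> X v u -> conn (u |: T).
Proof.
move=> cT vT Xvu.
have H a : a \in u |: T -> connect (inside (u |: T)) v a.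
  case/setU1P=> [->|aT].
    by apply/connect1/and3P; split; rewrite // !inE ?eqxx // vT orbT.
  by apply: connect_inside_sub (cT _ _ vT aT); apply: subsetUr.
move=> a b /H va /H vb; apply: connect_trans vb; by rewrite insideC.
Qed.

Section Black.

Variables (beta : pred P) (Ybeta : forall u v, beta u != beta v -> Y u v).

(** An edge whose ends differ in colour can be swapped, and one with equal colours needs no move, so
    each edge realises its transposition on colour patterns; a path does so by conjugation. Only
    colours are controlled, not the individual tokens. *)
Lemma recolor T a b s : connect (inside T) a b ->
  exists2 s', reach T s s' & forall x, beta (s' x) = beta (s (tperm a b x)).
Proof.
case/connectP=> p; elim: p a b s => [|c p IH] a b s /= pp ->.
  by exists s => // x; rewrite tperm1 perm1.
case/andP: pp => /and3P[Xac aT cT] pp.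
have edge s0 : exists2 s', reach T s0 s' & forall x, beta (s' x) = beta (s0 (tperm a c x)).
  case: (eqVneq (beta (s0 a)) (beta (s0 c))) => [e|ne].
    exists s0; first exact: reach_refl.
    by move=> x; case: tpermP => // ->.
  exists (sw a c s0); first by apply: reach_sw => //; apply: Ybeta.
  by move=> x; rewrite swE.
set d := last c p.
case: (eqVneq a d) => [<-|ad]; first by exists s => // x; rewrite tperm1 perm1.
case: (eqVneq c d) => [<-|cd]; first exact: edge.
have [s1 r1 e1] := edge s; have [s2 r2 e2] := IH c d s1 pp erefl.
have [s3 r3 e3] := edge s2.
exists s3; first by apply: reach_trans r3; apply: reach_trans r2.
move=> x; rewrite e3 e2 e1; congr (beta (s _)).
have -> : tperm a d = (tperm c d ^ tperm a c)%g by rewrite tpermJ tpermR tpermD.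
by rewrite /conjg tpermV !permM.
Qed.

Definition black s := [set x | beta (s x)].

Lemma reach_black T s s' : reach T s s' -> black s' :\: T = black s :\: T.
Proof. by case=> _ o; apply/setP=> x; rewrite !inE; case: (boolP (x \in T)) => //= /o ->. Qed.

(** Each use of [recolor] trades a black of [T] off [D] against a white on [D]; the equality of
    cardinals guarantees that such a black exists. *)
Lemma pattern T s D : conn T -> D \subset T -> #|D| = #|black s :&: T| ->
  exists2 s', reach T s s' & black s' :&: T = D.
Proof.
move=> cT sDT; move: {2}_.+1 (ltnSn #|D :\: black s|) => k.
elim: k s => // k IH s ltk cD.
case: (set_0Vmem (D :\: black s)) => [/eqP|[a]].
  rewrite setD_eq0 => sD; exists s; first exact: reach_refl.
  by apply/esym/eqP; rewrite eqEcard subsetI sD sDT cD leqnn.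
rewrite inE => /andP[nab aD].
have [b] : exists b, b \in (black s :&: T) :\: D.
  apply/set0Pn; rewrite setD_eq0; apply: contraNN nab => sbD.
  have /eqP e : black s :&: T == D by rewrite eqEcard sbD cD /=.
  by move: aD; rewrite -e inE => /andP[].
rewrite !inE => /and3P[bD bb bT].
have aT := subsetP sDT _ aD.
have ab : a != b by apply: contraNneq bD => <-.
have [s1 r1 e1] := recolor s (cT _ _ aT bT).
rewrite inE in nab.
have b1 x : x \in black s1 = (x == a) || (x != b) && (x \in black s).
  rewrite !inE e1; case: tpermP => [->|->|/eqP/negbTE -> /eqP -> //]; first by rewrite bb eqxx.
  by rewrite eqxx orbF eq_sym (negbTE ab) (negbTE nab).
have [] := IH s1.
- rewrite ltnS in ltk; apply: leq_trans ltk; apply: proper_card; apply/properP; split.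
    apply/subsetP=> x; rewrite !in_setD b1 negb_or negb_and negbK.
    case/andP=> [/andP[xa /orP[/eqP ->|->]]] //; by rewrite (negbTE bD).
  by exists a; rewrite !in_setD ?b1 ?eqxx // aD inE nab.
- rewrite cD.
  have -> : black s1 :&: T = a |: (black s :&: T) :\ b.
    apply/setP=> x; rewrite in_setI b1 !inE.
    by case: (eqVneq x a) => [->|_] /=; rewrite ?aT // andbA.
  rewrite cardsU1 (cardsD1 b (black s :&: T)) !inE bb bT (negbTE nab) /= andbF addSn. reflexivity.
by move=> s2 r2 e2; exists s2 => //; apply: reach_trans r2.
Qed.

End Black.

End Moves.

(** * Extending a good set *)

(* Abstracting the cardinals first keeps zify from comparing them up to conversion. *)
Ltac card_lia :=
  repeat match goal with
    | H : is_true (leq _ _) |- _ => revert H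
    | H : is_true (orb _ _) |- _ => revert H
    | H : @eq nat _ _ |- _ => revert H end;
  repeat match goal with |- context [ #|?A| ] => generalize (#|A|); intro end;
  repeat match goal with |- context [ size ?A ] => generalize (size A); intro end;
  clear; intros; lia.

Lemma card_between (V : finType) (A B : {set V}) (n : nat) :
  A \subset B -> #|A| <= n <= #|B| ->
  exists D : {set V}, [/\ A \subset D, D \subset B & #|D| = n].
Proof.
move=> sAB /andP[]; move: {2}(n - #|A|) (erefl (n - #|A|)) => k.
elim: k A sAB => [|k IH] A sAB e An nB.
  by exists A; split=> //; lia.
have [b] : exists b, b \in B :\: A.
  apply/set0Pn; rewrite setD_eq0; apply: contraTN nB => /subset_leq_card; lia.
rewrite inE => /andP[bA bB].
have cb : #|b |: A| = #|A|.+1 by rewrite cardsU1 bA.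
have [|||//|D [sD sDB cD]] := IH (b |: A); rewrite ?cb; try lia.
  by rewrite subUset sub1set bB.
by exists D; split=> //; apply: subset_trans sD; apply: subsetUr.
Qed.

Section Extension.

Variables (V P : finType) (X : sgraph V) (Y : sgraph P).
Variables (beta : pred P) (Ybeta : forall u v, beta u != beta v -> Y u v).
Implicit Types (s : bijection V P) (T D : {set V}).

(** Abstract, because it stands both for exchangeability and for exchangeability up to an odd
    permutation of the other class. *)
Variable E : bijection V P -> P -> P -> Prop.
Hypothesis E_sym : forall s u v, beta u -> beta v -> E s u v -> E s v u.
Hypothesis E_trans : forall s u v w, beta u -> beta v -> beta w ->
  E s u v -> E s v w -> E s u w.
Hypothesis E_move : forall s s' u v, beta u -> beta v ->
  connect (FS X Y) s s' -> E s u v -> E s' u v.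

Local Notation black := (black beta).
Local Notation reach := (reach X Y).

(* [fit] is what the pieces of the growth argument can always arrange: either
   every white token is available inside T, or T holds at most two blacks. *)
Definition fit T s := (#|black s :&: T| <= 2) || (~: black s \subset T).

Definition uniform T s := {in black s :&: T &, forall x y, E s (s x) (s y)}.

Definition good T := forall s, fit T s -> uniform T s.

(** Tokens of [T] end up in [T] and [E] is invariant under moves, so [T] may first be rearranged in
    any convenient way. *)
Lemma uniform_reach T s s' : reach T s s' -> uniform T s' -> uniform T s.
Proof.
move=> r us x y /setIP[]; rewrite inE => bx xT /setIP[]; rewrite inE => by_ yT.
have [x' x'T ex] := reach_pos r xT; have [y' y'T ey] := reach_pos r yT.
rewrite -ex -ey; apply: (@E_move s'); rewrite ?ex ?ey //.
  by rewrite FSC; case: r.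
by rewrite -ex -ey; apply: us; rewrite !inE ?ex ?ey ?bx ?by_ ?x'T ?y'T.
Qed.

Lemma reach_card T s s' : reach T s s' -> #|black s' :&: T| = #|black s :&: T|.
Proof.
move=> r; have e : #|black s'| = #|black s|.
  have H s0 : #|black s0| = #|[set u | beta u]|.
    rewrite -(card_imset _ (@bijI _ _ s0)); apply: eq_card => u; rewrite inE.
    apply/imsetP/idP => [[x]|bu]; first by rewrite inE => ? ->.
    by exists (bij_inv s0 u); rewrite ?inE bij_invK.
  by rewrite !H.
have := cardsID T (black s); have := cardsID T (black s').
by rewrite (reach_black _ r) e; card_lia.
Qed.

(** At most two blacks can be moved into [T], where goodness applies to them wherever the whites
    are. *)
Lemma small_uniform T T' s : conn X T' -> T \subset T' -> 2 <= #|T| ->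
  good T -> #|black s :&: T'| <= 2 -> uniform T' s.
Proof.
move=> cT' sTT T2 gT n2.
have [||D [_ sDT cD]] := @card_between _ set0 T #|black s :&: T'|.
- exact: sub0set.
- by rewrite cards0 /=; apply: leq_trans T2.
have [s1 r1 e1] := pattern Ybeta cT' (subset_trans sDT sTT) cD.
apply: (uniform_reach r1) => x y; rewrite e1 => xD yD.
have sD z : z \in D -> z \in black s1 :&: T.
  by move=> zD; rewrite inE (subsetP sDT _ zD) andbT; move: zD; rewrite -e1 => /setIP[].
apply: gT (sD _ xD) (sD _ yD); rewrite /fit (leq_trans _ n2) // -cD subset_leq_card //.
by rewrite -e1; apply: setIS.
Qed.

Lemma white_sub T s s' : reach T s s' -> ~: black s \subset T -> ~: black s' \subset T.
Proof.
move=> [_ o] /subsetP sT; apply/subsetP=> x; rewrite !inE; apply: contraNT => xT.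
rewrite o //; apply: contraNT xT => bx; apply: sT; by rewrite !inE.
Qed.

(** With [u], [z2] black and [p], [z1] white, the token on [u] runs along [p] to [z1]; then a black
    runs from [z2] along [p] to [u]. All whites are again in [T], so goodness relates the token that
    came from [u] to a third black that has stayed in place. *)
Lemma extend_pendant T u p z1 z2 m :
  conn X T -> good T -> 2 <= #|T| -> u \notin T ->
  path X u p -> uniq p -> {subset p <= T} -> 0 < size p < m ->
  (forall s, #|~: black s| = m) ->
  z1 \in T -> z2 \in T -> z1 != z2 -> z1 \notin p -> z2 \notin p ->
  X (last u p) z1 -> X (last u p) z2 -> good (u |: T).
Proof.
move=> cT gT T2 uT pp up sp /andP[p0 pm] cW z1T z2T z12 z1p z2p X1 X2.
have uv : exists2 v, v \in T & X v u.
  case: p p0 pp sp {up pm z1p z2p X1 X2} => // v p _ /= /andP[Xuv _] sp.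
  by exists v; [apply: sp; rewrite inE eqxx|rewrite edge_sym].
have cT' : conn X (u |: T) by case: uv => v vT Xvu; apply: conn_add Xvu.
move=> s /orP[n2|wT]; first by apply: (small_uniform cT' (subsetUr _ _)) n2.
case: (leqP #|black s :&: (u |: T)| 2) => n2.
  by apply: (small_uniform cT' (subsetUr _ _)) n2.
have up' z : z \in T -> z != u by move=> zT; apply: contraNneq uT => <-.
have pu : u \notin p by apply: contra uT => /sp.
(* The vertices to be made white; [size p < m] provides enough whites for them. *)
pose A := [set x in z1 :: p].
have [D [sD sDT cD]] : exists D : {set V},
    [/\ [set u; z2] \subset D, D \subset (u |: T) :\: A
      & #|D| = #|black s :&: (u |: T)|].
  apply: card_between.
    rewrite subUset !sub1set !inE eqxx /= negb_or eq_sym (negbTE (up' _ z1T)) pu.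
    by rewrite z2T orbT andbT (negbTE z2p) orbF eq_sym z12.
  rewrite cards2 eq_sym (up' _ z2T) (ltnW n2) /=.
  have sub : A \subset u |: T.
    apply/subsetP=> x; rewrite !inE => /orP[/eqP ->|/sp ->]; by rewrite ?z1T orbT.
  have := cardsID A (u |: T).
  rewrite (setIidPr sub).
  have -> : #|A| = (size p).+1.
    by rewrite cardsE; apply/card_uniqP; rewrite /= z1p up.
  have := cardsID (black s) (u |: T).
  rewrite setIC; have -> : (u |: T) :\: black s = ~: black s.
    by rewrite setDE; apply/setIidPr.
  by rewrite (cW s) => e1 e2; rewrite -(leq_add2r m) e1 -e2 addnC leq_add2l.
have [s1 r1 e1] := pattern Ybeta cT' (subset_trans sDT (subsetDl _ _)) cD.
apply: (uniform_reach r1); have {}wT := white_sub r1 wT.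
have uD : u \in D by apply: (subsetP sD); rewrite !inE eqxx.
have z2D : z2 \in D by apply: (subsetP sD); rewrite !inE eqxx orbT.
have colT s0 x : x \in u |: T -> (x \in black s0) = (x \in black s0 :&: (u |: T)).
  by move=> xT; rewrite [RHS]inE xT andbT.
(* A black on [u] forces all the whites into [T], so that goodness of [T] applies. *)
have whT s0 : ~: black s0 \subset u |: T -> u \in black s0 -> good T -> uniform T s0.
  move=> w bu; apply; apply/orP; right; apply/subsetP=> x xw.
  have := subsetP w _ xw; case/setU1P=> // xu; by rewrite inE xu bu in xw.
have b1u : u \in black s1 by rewrite colT ?setU11 // e1.
have U1 := whT _ wT b1u gT.
(* A third black, off both routes, serves as the common reference. *)
have [k] : exists k, k \in D :\: [set u; z2].
  apply/set0Pn; rewrite -card_gt0; have := cardsID [set u; z2] D.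
  rewrite (setIidPr sD) cards2 => cD2; rewrite lt0n; apply: contraTneq n2 => c0.
  by rewrite -cD -cD2 c0 addn0; case: (u != z2).
rewrite !inE negb_or => /andP[/andP[ku kz2] kD].
have := subsetP sDT _ kD; rewrite !inE negb_or (negbTE ku) /= => /andP[/andP[kz1 kp] kT].
have b1k : k \in black s1 by rewrite colT ?e1 // !inE kT orbT.
have b1z : z2 \in black s1 by rewrite colT ?e1 // !inE z2T orbT.
have b1p x : x \in z1 :: p -> x \notin black s1.
  move=> xp; rewrite colT ?e1; last first.
    by move: xp; rewrite !inE => /orP[/eqP ->|/sp ->]; rewrite ?z1T orbT.
  by apply: contraL xp => /(subsetP sDT); rewrite !inE => /andP[].
pose A1 := [set x in u :: rcons p z1].
have c1 : connect (inside X A1) u z1.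
  rewrite -[z1](last_rcons u p); apply: path_inside.
    by rewrite rcons_path pp.
  by move=> x xp; rewrite inE.
have [s2 r2 e2] := recolor Ybeta s1 c1.
have z1u : z1 != u := up' _ z1T.
(* The only black on this route starts at [u], so the black found on [z1] is that very token,
   although [recolor] speaks of colours only. *)
have s2z1 : s2 z1 = s1 u.
  have uA1 : u \in A1 by rewrite !inE eqxx.
  have [y yA ey] := reach_pos r2 uA1.
  have : y \in black s2 by rewrite inE ey; move: b1u; rewrite inE.
  rewrite inE e2; case: tpermP => [yu|yz1|yu yz1].
  - by move: (b1p z1); rewrite !inE eqxx => /(_ isT) /negbTE ->.
  - by rewrite -yz1 ey.
  - move: yA; rewrite !inE mem_rcons => /orP[/eqP //|yp] by1.
    by move: (b1p y yp); rewrite inE by1.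
pose A2 := [set x in z2 :: u :: p].
have c2 : connect (inside X A2) z2 u.
  rewrite insideC -{1}[z2](last_rcons u p).
  apply: path_inside; first by rewrite rcons_path pp.
  by move=> x; rewrite !inE mem_rcons inE; case: (x == u); case: (x == z2).
have [s3 r3 e3] := recolor Ybeta s2 c2.
have off2 x : x \in T -> x != z1 -> x \notin p -> s2 x = s1 x.
  move=> xT xz xp; case: r2 => _; apply; rewrite !inE mem_rcons !inE.
  by rewrite (negbTE (up' _ xT)) (negbTE xz).
have off3 x : x \in T -> x != z2 -> x \notin p -> s3 x = s2 x.
  move=> xT xz xp; case: r3 => _; apply; rewrite !inE.
  by rewrite (negbTE (up' _ xT)) (negbTE xz).
have z21 : z2 != z1 by rewrite eq_sym.
have b3u : u \in black s3.
  rewrite inE e3 tpermR off2 //; by move: b1z; rewrite inE.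
have r3' : reach (u |: T) s1 s3.
  apply: (@reach_trans _ _ _ _ _ _ s2).
    apply: reach_sub r2; apply/subsetP=> x; rewrite !inE mem_rcons inE.
    by case/or3P=> [->//|/eqP ->|/sp ->]; rewrite ?z1T orbT.
  apply: reach_sub r3; apply/subsetP=> x; rewrite !inE.
  by case/or3P=> [/eqP ->|->//|/sp ->]; rewrite ?z2T orbT.
have U3 := whT _ (white_sub r3' wT) b3u gT.
have kz2' : k != z2 by [].
have s3k : s3 k = s1 k by rewrite off3 // off2.
have s3z : s3 z1 = s1 u by rewrite off3 // s2z1.
have Eku : E s1 (s1 u) (s1 k).
  rewrite -s3k -s3z; have bz : z1 \in black s3 by rewrite inE s3z; move: b1u; rewrite inE.
  have bk : k \in black s3 by rewrite inE s3k; move: b1k; rewrite inE.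
  apply: (@E_move s3); first by move: bz; rewrite inE.
  - by move: bk; rewrite inE.
  - by rewrite FSC; case: r3'.
  by apply: U3; rewrite !inE ?kT ?z1T andbT; [move: bz|move: bk]; rewrite inE.
have bb x : x \in black s1 -> beta (s1 x) by rewrite inE.
have Ek x : x \in black s1 :&: (u |: T) -> E s1 (s1 x) (s1 k).
  case/setIP=> bx /setU1P[->//|xT]; apply: U1; by apply/setIP.
move=> x y xb yb; have [bx _] := setIP xb; have [by_ _] := setIP yb.
by apply: (@E_trans _ _ (s1 k)); rewrite ?bb //; [|apply: E_sym; rewrite ?bb //]; apply: Ek.
Qed.

Lemma conn_add_path T v p : conn X T -> v \in T -> path X v p ->
  conn X (T :|: [set x in p]).
Proof.
elim: p T v => [|u p IH] T v cT vT /=.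
  move=> _; have -> : [set x in [::]] = set0 :> {set V} by apply/setP=> x; rewrite !inE.
  by rewrite setU0.
case/andP=> Xvu pp.
have -> : T :|: [set x in u :: p] = (u |: T) :|: [set x in p].
  by apply/setP=> x; rewrite !inE orbA [(x \in T) || _]orbC.
by apply: IH pp; [apply: conn_add Xvu|rewrite setU11].
Qed.

(** Tokens on the ear are moved back towards [v] one vertex at a time, by means of a white that
    enters the ear at [v] and leaves it at [b]. *)
Lemma extend_ear T v es b :
  conn X T -> good T -> 3 <= #|T| -> (forall s, 0 < #|~: black s|) ->
  v \in T -> b \in T -> v != b -> {subset es <= ~: T} -> uniq es ->
  path X v (rcons es b) -> good (T :|: [set x in es]).
Proof.
move=> cT gT T3 W0 vT bT vb esT ue pe.
set T' := T :|: _.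
have [pv Xlb] : path X v es /\ X (last v es) b by move: pe; rewrite rcons_path => /andP[].
have cT' : conn X T' by apply: conn_add_path pv.
have sT : T \subset T' by apply: subsetUl.
have T2 : 2 <= #|T| by apply: ltnW.
move=> s /orP[n2|wT]; first by apply: (small_uniform cT' sT).
case: (leqP #|black s :&: T'| 2) => n2; first by apply: (small_uniform cT' sT).
have [q qE] : exists q, #|black s :&: T'| = q by eexists.
rewrite qE in n2.
have cA : #|[set x in es]| = size es by rewrite cardsE; apply/card_uniqP.
have dis : [disjoint T & [set x in es]].
  rewrite disjoint_sym disjoint_subset; apply/subsetP=> x; rewrite !inE => /esT.
  by rewrite inE.
have split0 D : #|D :&: T'| = #|D :&: T| + #|D :&: [set x in es]|.
  rewrite setIUr cardsU -setIIr; move: dis; rewrite -setI_eq0 => /eqP ->.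
  by rewrite setI0 cards0 subn0.
have qT : q < #|T| + size es.
  have := cardsID (black s) T'; rewrite setIC qE.
  have -> : T' :\: black s = ~: black s by rewrite setDE; apply/setIidPr.
  have := W0 s; have := split0 setT; rewrite !setTI cA; card_lia.
(* The number of blacks to be kept in [T]: the ear is filled as far as possible while two blacks
   stay in [T]. Either [c] is 2, or the ear is full and all whites lie in [T]; in both cases [T] is
   fit. *)
have [c cE] : exists c, c = q - minn (size es) (q - 2) by eexists.
have [c2 cq cT3 ch] : [/\ 2 <= c, c <= q, c < #|T| & (c <= 2) || (c + size es <= q)].
  by rewrite cE; split; clear cE; card_lia.
pose K s := [/\ ~: black s \subset T', #|black s :&: T'| = q & #|black s :&: T| = c].
have Kfit s0 : K s0 -> fit T s0.
  case=> w0 q0 c0; apply/orP; case/orP: ch => [c3|ch]; [left|right]; first by rewrite c0.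
  have e0 : black s0 :&: [set x in es] = [set x in es].
    apply/eqP; rewrite eqEcard subsetIr cA; have := split0 (black s0); rewrite q0 c0; card_lia.
  apply/subsetP=> x xw; have := subsetP w0 _ xw; case/setUP=> // xe.
  by move: xe; rewrite -e0 => /setIP[xb _]; rewrite inE xb in xw.
have Kmove s0 s1 : K s0 -> reach T' s0 s1 -> #|black s1 :&: T| = c -> K s1.
  case=> w0 q0 _ r c1; split=> //; first exact: white_sub r w0.
  by rewrite (reach_card r).
have Ksub s0 s1 : K s0 -> reach T s0 s1 -> K s1.
  move=> k0 r; apply: (Kmove _ _ k0 (reach_sub sT r)); rewrite (reach_card r).
  by case: k0.
(* Induction step along the ear, from the predecessor [last v e1] of [x] to [x]; for the first
   vertex of the ear the predecessor is [v]. *)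
have step e1 x e2 s0 : es = e1 ++ x :: e2 ->
    (forall s', K s' -> last v e1 \in black s' ->
       forall k, k \in black s' :&: T -> E s' (s' (last v e1)) (s' k)) ->
    K s0 -> x \in black s0 ->
    forall k, k \in black s0 :&: T -> E s0 (s0 x) (s0 k).
  move=> ees; set y := last v e1 => IH K0 bx0 k0 /setIP[bk0 k0T].
  have bb s' z : z \in black s' -> beta (s' z) by rewrite inE.
  have xes : x \in es by rewrite ees mem_cat !inE eqxx orbT.
  have nT z : z \in es -> z \notin T by move/esT; rewrite inE.
  have vs : v \notin es by apply: contraL vT => /nT.
  have uves : uniq ((v :: e1) ++ x :: e2) by rewrite /= -ees vs ue.
  have ye : y \in v :: e1 by apply: mem_last.
  (* As [c < #|T|], the vertex [v] can be white while [b] is black; as [2 <= c], there is another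
     black [k] in [T]. *)
  have [D [sD sDT cD]] : exists D, [/\ [set b] \subset D, D \subset T :\ v & #|D| = c].
    apply: card_between; first by rewrite sub1set !inE eq_sym vb.
    by rewrite cards1; have := cardsD1 v T; rewrite vT; card_lia.
  have [|s1 r1 e1T] := pattern Ybeta cT (subset_trans sDT (subsetDl _ _)) (s := s0).
    by rewrite cD; case: K0.
  have K1 := Ksub _ _ K0 r1.
  have s1x : s1 x = s0 x by case: r1 => _; apply; apply: nT.
  have [k1 k1T s1k] := reach_pos r1 k0T.
  have bx1 : x \in black s1 by rewrite inE s1x bb.
  have bk1 : k1 \in black s1 by rewrite inE s1k bb.
  have colT z : z \in T -> (z \in black s1) = (z \in D) by move=> zT; rewrite -e1T in_setI zT andbT.
  have bv1 : v \notin black s1 by rewrite colT //; apply/negP=> /(subsetP sDT); rewrite !inE eqxx.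
  have bb1 : b \in black s1 by rewrite colT // (subsetP sD) ?inE.
  have [k] : exists k, k \in D :\ b.
    by apply/set0Pn; rewrite -card_gt0; have := cardsD1 b D; rewrite -sub1set sD cD; card_lia.
  rewrite !inE => /andP[kb kD].
  have [kv kT] : k != v /\ k \in T by have := subsetP sDT _ kD; rewrite !inE => /andP[].
  have bk : k \in black s1 by rewrite colT.
  suff Exk : E s1 (s1 x) (s1 k).
    apply: (E_move _ _ (s := s1)); rewrite ?bb //; first by rewrite FSC; case: r1.
    rewrite -s1x -s1k; apply: E_trans Exk _; rewrite ?bb //.
    by apply: (gT _ (Kfit _ K1)); apply/setIP.
  have ks z : z \in T -> z \notin es by apply: contraL => /nT.
  have e1s : {subset e1 <= es} by move=> z ze; rewrite ees mem_cat ze.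
  have e2s : {subset e2 <= es} by move=> z ze; rewrite ees mem_cat inE ze !orbT.
  have esT' z : z \in es -> z \in T' by rewrite !inE => ->; rewrite orbT.
  have xT' : x \in T' by apply: esT'.
  have yT' : y \in T' by move: ye; rewrite inE => /orP[/eqP ->|/e1s/esT' //]; rewrite inE vT.
  have Xyx : X y x by move: pv; rewrite ees cat_path => /andP[_ /= /andP[]].
  have kx : k != x by apply: contraNneq (ks _ kT) => ->.
  have [xve yxe] : x \notin v :: e1 /\ y \notin x :: e2.
    move: uves; rewrite cat_uniq => /and3P[_ /hasPn h _]; split.
      by apply: h; rewrite inE eqxx.
    by apply: contraL ye => /h.
  have yx : y != x by apply: contraNneq yxe => ->; rewrite inE eqxx.
  have yb : y != b.
    move: ye; rewrite inE => /orP[/eqP -> //|/e1s]; apply: contraTneq => ->; exact: ks.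
  (* A white on [y], still on the ear, lets the token step there without any change in [T]. *)
  case: (boolP ((y \notin black s1) && (y != v))) => [/andP[wy yv]|ncase].
    have yes : y \in es by move: ye; rewrite inE (negbTE yv) => /e1s.
    have r2 : reach T' s1 (sw x y s1).
      apply: reach_sw => //; first by rewrite edge_sym.
      by apply: Ybeta; rewrite (bb _ _ bx1); move: wy; rewrite inE => /negbTE ->.
    have s2T z : z \in T -> sw x y s1 z = s1 z.
      by move=> zT; rewrite swE tpermD //; apply: contraNneq (ks _ zT) => <-.
    have s2y : sw x y s1 y = s1 x by rewrite swE tpermR.
    have K2 : K (sw x y s1).
      apply: (Kmove _ _ K1 r2); case: K1 => _ _ <-; apply: eq_card => z.
      by rewrite !inE; case: (boolP (z \in T)) => [/s2T ->|]; rewrite ?andbF.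
    apply: (E_move _ _ (s := sw x y s1)); rewrite ?bb //; first by rewrite FSC; case: r2.
    rewrite -s2y -(s2T k) //; apply: IH => //; first by rewrite inE s2y bb.
    by rewrite !inE s2T // bb.
  (* Otherwise a white is passed from [v] to [y], exchanged with the token on [x], and passed on
     from [x] to [b]. In [T] this trades the black on [b] for one on [v], so [K] is preserved. *)
  have cvy : connect (inside X [set z in v :: e1]) v y.
    apply: path_inside; last by move=> z ze; rewrite inE.
    by move: pv; rewrite ees cat_path => /andP[].
  have [s2 [cr2 o2] e2c] := recolor Ybeta s1 cvy.
  have wy2 : beta (s2 y) = false.
    by rewrite e2c tpermR; move: bv1; rewrite inE => /negbTE.
  have s2x : s2 x = s1 x by apply: o2; rewrite inE.
  have r3 : connect (FS X Y) s2 (sw x y s2).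
    apply: connect_sw; first by rewrite edge_sym.
    by apply: Ybeta; rewrite wy2 s2x (bb _ _ bx1).
  set s3 := sw x y s2 in r3.
  have cxb : connect (inside X [set z in x :: rcons e2 b]) x b.
    rewrite -{2}[b](last_rcons x e2); apply: path_inside; last by move=> z ze; rewrite inE.
    by move: pe; rewrite ees rcons_cat cat_path => /andP[_ /= /andP[]].
  have [s4 [cr4 o4] e4c] := recolor Ybeta s3 cxb.
  have s2T z : z \in T -> z != v -> s2 z = s1 z.
    move=> zT zv; apply: o2; rewrite !inE (negbTE zv) /=.
    by apply: contraL zT => /e1s/nT.
  have s4T z : z \in T -> z != b -> s4 z = s3 z.
    move=> zT zb; apply: o4; rewrite inE -rcons_cons mem_rcons inE (negbTE zb) /=.
    by apply: contraL zT; rewrite inE => /orP[/eqP ->|/e2s]; apply: nT.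
  have s3T z : z \in T -> z != y -> s3 z = s2 z.
    move=> zT zy; rewrite /s3 swE tpermD 1?eq_sym //.
    by apply: contraNneq (ks _ zT) => ->.
  have s3y : s3 y = s1 x by rewrite /s3 swE tpermR.
  have s4y : s4 y = s1 x.
    rewrite -s3y; apply: o4; rewrite inE -rcons_cons mem_rcons inE (negbTE yb) /=.
    exact: yxe.
  have ky : k != y.
    apply: contraNneq kv => ky; move: ye; rewrite -ky inE => /orP[//|/e1s].
    by rewrite (negbTE (ks _ kT)).
  have s4k : s4 k = s1 k by rewrite s4T // s3T // s2T.
  have b4v : v \in black s4.
    rewrite inE s4T //; move: ncase; rewrite negb_and !negbK.
    case: (eqVneq y v) => [<- _|yv]; first by rewrite s3y bb.
    rewrite orbF => by1; rewrite s3T 1?eq_sym // e2c tpermL.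
    by rewrite bb.
  have w4b : b \notin black s4.
    by rewrite inE e4c tpermR /s3 swE tpermL wy2.
  have r4 : reach T' s1 s4.
    split; first by apply: connect_trans cr4; apply: connect_trans r3.
    move=> z zT'; have zT : z \notin T by apply: contra zT' => zT; rewrite inE zT.
    have ze : z \notin es by apply: contra zT' => /esT'.
    have zx : z != x by apply: contraNneq zT' => ->.
    have zy : z != y by apply: contraNneq zT' => ->.
    have zv : z != v by apply: contraNneq zT => ->.
    have zb : z != b by apply: contraNneq zT => ->.
    rewrite o4; last first.
      rewrite inE -rcons_cons mem_rcons !inE (negbTE zb) (negbTE zx) /=.
      by apply: contra ze => /e2s.
    rewrite /s3 swE tpermD 1?eq_sym // o2 // !inE (negbTE zv) /=.
    by apply: contra ze => /e1s.
  have K4 : K s4.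
    apply: (Kmove _ _ K1 r4).
    have -> : black s4 :&: T = v |: (black s1 :&: T) :\ b.
      apply/setP=> z; rewrite in_setI in_setU1 in_setD1 in_setI.
      case: (boolP (z \in T)) => zT; last first.
        by rewrite !andbF; apply/esym/negbTE; rewrite orbF; apply: contraNneq zT => ->.
      rewrite !andbT; case: (eqVneq z v) => [-> //|zv]; case: (eqVneq z b) => [->|zb] /=.
        exact/negbTE.
      rewrite [in LHS]inE s4T //; case: (eqVneq z y) => [zy|zy]; last by rewrite s3T // s2T // inE.
      move: ye; rewrite -zy inE (negbTE zv) => /e1s; by rewrite (negbTE (ks _ zT)).
    have := cardsD1 b (black s1 :&: T); rewrite cardsU1 in_setD1 !in_setI bb1 bT (negbTE bv1).
    by case: K1 => _ _ ->; rewrite andbF /=; card_lia.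
  apply: (E_move _ _ (s := s4)); rewrite ?bb //; first by rewrite FSC; case: r4.
  rewrite -s4y -s4k; apply: IH => //; first by rewrite inE s4y bb.
  by rewrite !inE s4k bb.
have main e1 : forall e2 x s0, es = e1 ++ x :: e2 -> K s0 -> x \in black s0 ->
    forall k, k \in black s0 :&: T -> E s0 (s0 x) (s0 k).
  elim/last_ind: e1 => [|e1 y IH] e2 x s0 ees; apply: (step _ _ _ _ ees) => s' K'.
    by move=> bv k kP; apply: (gT _ (Kfit _ K')) => //; apply/setIP.
  rewrite last_rcons; apply: (IH (x :: e2)) K'.
  by rewrite ees cat_rcons.
have [D1 [_ D1T D1c]] := @card_between _ set0 T c (sub0set _) ltac:(rewrite cards0; card_lia).
have [|D2 [_ D2T D2c]] := @card_between _ set0 [set x in es] (q - c) (sub0set _).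
  rewrite cards0 cA cE; card_lia.
have D12 : [disjoint D1 & D2] by apply: disjointWl D1T _; apply: disjointWr D2T _.
have [||s1 r1 e1] := @pattern _ _ X Y beta Ybeta T' s (D1 :|: D2) cT'.
- by apply: setUSS.
- rewrite cardsU D1c D2c; move: D12; rewrite -setI_eq0 => /eqP ->.
  by rewrite cards0 qE; card_lia.
have K1 : K s1.
  split; [exact: white_sub r1 wT|by rewrite (reach_card r1)|].
  have -> : black s1 :&: T = D1.
    have -> : black s1 :&: T = (black s1 :&: T') :&: T by rewrite -setIA (setIidPr sT).
    rewrite e1 setIUl (setIidPl D1T).
    have /eqP -> : D2 :&: T == set0 by rewrite setI_eq0 disjoint_sym; apply: disjointWr D2T _.
    by rewrite setU0.
  by [].
apply: (uniform_reach r1); have U1 := gT _ (Kfit _ K1).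
have [k kP] : exists k, k \in black s1 :&: T.
  by apply/set0Pn; rewrite -card_gt0; case: K1 => _ _ ->; card_lia.
have Ek x : x \in black s1 :&: T' -> E s1 (s1 x) (s1 k).
  case/setIP=> bx /setUP[xT|]; first by apply: U1 => //; apply/setIP.
  rewrite inE => xe.
  have [e1' [e2 ees]] : exists e1' e2, es = e1' ++ x :: e2.
    by case/splitPr: xe => e1' e2; exists e1', e2.
  exact: main ees K1 bx _ kP.
have bb x : x \in black s1 -> beta (s1 x) by rewrite inE.
have [bk _] := setIP kP.
move=> x y xb yb; have [bx _] := setIP xb; have [by_ _] := setIP yb.
by apply: (@E_trans _ _ (s1 k)); rewrite ?bb //; [|apply: E_sym; rewrite ?bb //]; apply: Ek.
Qed.

End Extension.

(** * Existence of an extension *)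

Section Structure.

Variables (V : finType) (X : sgraph V).
Implicit Types (T : {set V}).

Definition pendant_ext m T := exists u p z1 z2,
  [/\ u \notin T, path X u p, uniq p, {subset p <= T} & 0 < size p < m] /\
  [/\ z1 \in T, z2 \in T, z1 != z2, (z1 \notin p) && (z2 \notin p)
    & X (last u p) z1 && X (last u p) z2].

(** [es] is nonempty so that the ear really enlarges [T]. *)
Definition ear_ext T := exists v es b,
  [/\ v \in T, b \in T, v != b, {subset es <= ~: T}
    & uniq es /\ path X v (rcons es b)] /\ es <> [::].

Lemma conn_closed T (A : {set V}) : conn X T -> A \subset T -> A != set0 ->
  (forall x y, x \in A -> y \in T -> X x y -> y \in A) -> T \subset A.
Proof.
move=> cT sA /set0Pn[a aA] cl; apply/subsetP=> t tT.
case/connectP: (cT _ _ (subsetP sA _ aA) tT) => p.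
elim: p a aA => [|b p IH] a aA /= pp et; first by rewrite et.
case/andP: pp => /and3P[Xab _ bT] pp; apply: (IH b) => //.
exact: cl Xab.
Qed.

(* A path hanging from the rest of T, most recently added vertex first: apart
   from the head, its vertices have no neighbour in T outside the path. *)
Fixpoint hang T (u : V) (l : seq V) : bool :=
  match l with
  | [::] => true
  | a :: t =>
      (if t is b :: t' then
         X a b && [forall w in T, X b w ==> (w == a) || (w == head a t')]
       else X a u) && hang T u t
  end.

Section Hang.

Variables (T : {set V}) (u : V).

(** For empty [l] the default makes [head a l] equal to [a], so that [a] is then the only neighbour
    of [b] allowed in [T]. *)
Lemma hang_cons2 a b l : hang T u (a :: b :: l) =
  (X a b && [forall w in T, X b w ==> (w == a) || (w == head a l)]) && hang T u (b :: l).
Proof. by []. Qed.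

Lemma hang_tail b t v w : hang T u (b :: t) -> v \in t -> w \in T -> X v w ->
  (w \in t) || (v == head b t) && (w == b).
Proof.
elim: t b => // c t IH b; rewrite hang_cons2 => /andP[/andP[Xbc /forallP nc] ht] vct wT Xvw.
case: (eqVneq v c) => [vc|vc] /=.
  have := nc w; rewrite -vc wT Xvw /= => /orP[->|]; first by rewrite orbT.
  case: t {IH ht nc vct Xbc} => [|d t] /=; first by move->; rewrite orbT.
  by move=> /eqP ->; rewrite !inE eqxx orbT.
rewrite inE (negbTE vc) /= in vct.
have := IH c ht vct wT Xvw; rewrite inE orbF => /orP[->|]; first by rewrite orbT.
by case/andP=> _ /eqP ->; rewrite eqxx.
Qed.

Lemma hang_nbr l v : hang T u l -> v \in behead l ->
  exists w1 w2, forall w, w \in T -> X v w -> w = w1 \/ w = w2.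
Proof.
case: l => // a l; rewrite [behead _]/=; elim: l a => // b l IH a.
rewrite hang_cons2 => /andP[/andP[_ /forallP nb] hl].
rewrite inE => /orP[/eqP ->|]; last exact: IH hl.
exists a, (head a l) => w wT Xbw; have := nb w; rewrite wT Xbw /=.
by case/orP=> /eqP; [left|right].
Qed.

Lemma hang_drop l1 l2 : hang T u (l1 ++ l2) -> hang T u l2.
Proof. by elim: l1 => //= a l1 IH /andP[_ /IH]. Qed.

Lemma hang_path l : l != [::] -> hang T u l -> path X u (rev l).
Proof.
elim: l => // a [|b l] IH _; first by rewrite /= !andbT edge_sym.
rewrite hang_cons2 => /andP[/andP[Xab _] h]; rewrite rev_cons rcons_path IH //= rev_cons last_rcons.
by rewrite edge_sym.
Qed.

Lemma hang_sorted l : hang T u l -> sorted X l.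
Proof.
elim: l => // a [|b l] IH //; rewrite hang_cons2 => /andP[/andP[Xab _] h] /=.
by rewrite Xab; apply: IH.
Qed.

End Hang.

(** Take [A] together with the vertices outside [T] that are reached from it without meeting [T]
    again. As [b] is not among them, some [e]-edge leaves this set; it ends in [T] off [A] and
    closes an ear, which by the last hypothesis is not a single edge. *)
Lemma ear_from T (A : {set V}) a b (e : rel V) : subrel e X -> A \subset T ->
  a \in A -> b \in T -> b \notin A -> connect e a b ->
  (forall v w, v \in A -> w \in T -> w \notin A -> ~~ e v w) -> ear_ext T.
Proof.
move=> eX sAT aA bT bA cab eA.
pose g x y := X x y && (y \notin T).
pose inS w := (w \in A) || (w \notin T) && [exists v in A, connect g v w].
have inSP w : inS w -> exists2 v, v \in A & connect g v w.
  case/orP=> [wA|/andP[_ /existsP[v /andP[]]]]; first by exists w.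
  by exists v.
case: (boolP [exists x, exists y, [&& inS x, e x y & ~~ inS y]]) => [|none].
  case/existsP=> x /existsP[y /and3P[Sx exy nSy]].
  have yA : y \notin A by apply: contra nSy => yA; rewrite /inS yA.
  have [v vA cvx] := inSP _ Sx.
  have yT : y \in T.
    apply: contraR nSy => yT; rewrite /inS (negbTE yA) yT /=; apply/existsP; exists v.
    rewrite vA /=; apply: connect_trans cvx _; apply: connect1; by rewrite /g eX.
  case/connectP: cvx => p0 gp0 ex0; case: (shortenP gp0) ex0 => p gp up _ ex {p0 gp0}.
  have pX : path X v p by apply: sub_path gp => i j /andP[].
  have pT : {subset p <= ~: T}.
    move: gp {ex up pX}; elim: p {vA} v => // z p IH v /= /andP[/andP[_ zT] gp] i.
    by case/predU1P=> [->|]; [rewrite inE|exact: (IH z gp i)].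
  exists v, p, y; split.
    split=> //; first exact: (subsetP sAT).
      by apply: contraNneq yA => <-.
    split; first by case/andP: up.
    by rewrite rcons_path pX -ex eX.
  move=> p0; rewrite p0 /= in ex; rewrite ex in exy.
  by move: (eA v y vA yT yA); rewrite exy.
have cl x y : connect e x y -> inS x -> inS y.
  case/connectP=> p; elim: p x => [|z p IH] x /=; first by move=> _ ->.
  case/andP=> exz ep ey Sx; apply: (IH z) => //; apply: contraR none => nz.
  by apply/existsP; exists x; apply/existsP; exists z; rewrite Sx exz.
have : inS b by apply: cl cab _; rewrite /inS aA.
by rewrite /inS (negbTE bA) bT.
Qed.

Lemma del_edge_sym a b : symmetric (del_edge X a b).
Proof.
move=> x y; rewrite /del_edge edge_sym !xpair_eqE /=.
by rewrite [(y == a) && _]andbC [(y == b) && _]andbC; congr (_ && _); rewrite andbC.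
Qed.

Lemma n_comp_connected : connected X -> n_comp X V <= 1.
Proof.
move=> cX; apply/card_le1_eqP => x y; rewrite !inE !andbT => /eqP rx /eqP ry.
rewrite -rx -ry; apply/eqP; rewrite root_connect //.
exact/sym_connect_sym/edge_sym.
Qed.

Lemma not_cut_edge a b : connected X -> X a b -> ~~ cut_edge X a b ->
  connect (del_edge X a b) a b.
Proof.
move=> cX Xab; rewrite /cut_edge Xab /=; apply: contraR => nc.
have sym : connect_sym (del_edge X a b) by apply/sym_connect_sym/del_edge_sym.
apply: (leq_ltn_trans (n_comp_connected cX)).
apply/card_gt1P; exists (root (del_edge X a b) a), (root (del_edge X a b) b).
by split; rewrite ?inE ?roots_root // root_connect.
Qed.

Lemma deg_neq1 v w w' : X v w -> X v w' -> w != w' -> deg X v <> 1.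
Proof.
move=> vw vw' ww' /eqP/cards1P[z ez]; have := ww'.
have: w \in [set z] by rewrite -ez inE.
have: w' \in [set z] by rewrite -ez inE.
by rewrite !inE => /eqP -> /eqP ->; rewrite eqxx.
Qed.

(** From a neighbour in [T] of an outside vertex [u], walk into [T] as long as the head has exactly
    one new neighbour there. Two new neighbours give a pendant extension; none would make the walk
    exhaust [T], against the three neighbours of [z]. A walk with [m] vertices that yields no
    extension is an [m]-bridge. *)
Lemma extend_exists m T z :
  2 <= m -> connected X -> ~ has_bridge X m -> conn X T -> T != setT ->
  z \in T -> 2 < #|[set w in T | X z w]| ->
  pendant_ext m T \/ ear_ext T.
Proof.
move=> m2 cX nbr cT TT zT z3.
have z3' w1 w2 : ~ (forall w, w \in T -> X z w -> w = w1 \/ w = w2).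
  move=> h; have : [set w in T | X z w] \subset [set w1; w2].
    by apply/subsetP=> w; rewrite !inE => /andP[/h H /H [] ->]; rewrite eqxx ?orbT.
  move/subset_leq_card; rewrite cards2 leqNgt => /negP[]; apply: leq_trans z3.
  by case: (_ != _).
have [v0 [u [v0T uT Xvu]]] : exists v u, [/\ v \in T, u \notin T & X v u].
  have [w wT] : exists w, w \notin T.
    by apply/existsP; move: TT; apply: contraR; rewrite negb_exists => /forallP h;
       apply/eqP/setP=> x; rewrite inE; apply: contraT => /(negP (h x)).
  case/connectP: (cX z w) => p; elim: p z zT {z3 z3'} => [|y p IH] x xT /=.
    by move=> _ e; rewrite e xT in wT.
  case/andP=> Xxy pp e; case: (boolP (y \in T)) => yT; first exact: IH pp e.
  by exists x, y.
pose G l := [/\ hang T u l, uniq l & {subset l <= T}].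
have Xaa a : X a a = false by apply: edge_irr.
(* A head without further neighbours in [T] makes the path exhaust [T]. For empty [l] the value
   [head a l] is [a], so the hypothesis then excludes every neighbour in [T]. *)
have whole a l : hang T u (a :: l) -> {subset a :: l <= T} ->
    (forall w, w \in T -> X a w -> w = head a l) -> False.
  move=> hl sl hd.
  have cl x y : x \in [set x in a :: l] -> y \in T -> X x y -> y \in [set x in a :: l].
    rewrite !inE => /orP[/eqP ->|xl] yT Xxy.
      rewrite (hd y) //; case: (l) => [|b l'] /=; first by rewrite eqxx.
      by rewrite inE eqxx orbT.
    by have := hang_tail hl xl yT Xxy; case/orP=> [->|/andP[_ ->]]; rewrite ?orbT.
  have /subsetP/(_ z zT) : T \subset [set x in a :: l].
    apply: conn_closed cl => //; first by apply/subsetP=> x; rewrite inE; apply: sl.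
    by apply/set0Pn; exists a; rewrite !inE eqxx.
  rewrite !inE => /orP[/eqP za|zl].
    by case: (z3' (head a l) (head a l)) => w wT; rewrite za => /(hd w wT); left.
  by have [w1 [w2 /z3']] := hang_nbr (v := z) hl zl.
have step q : 0 < q <= m -> pendant_ext m T \/ exists2 l, G l & size l = q.
  elim: q => // q IH /= qm; case: (posnP q) => [->|q0].
    right; exists [:: v0] => //; split; rewrite //= ?Xvu //.
    by move=> x; rewrite inE => /eqP ->.
  have [|?|[l [hl ul sl] el]] := IH; [by lia|by left|].
  case: l el hl ul sl => [|a l] el; first by rewrite -el in q0.
  move=> hl ul sl.
  have aT : a \in T by apply: sl; rewrite inE eqxx.
  pose N := [set w in T | X a w & w \notin l].
  have Nl w : w \in T -> X a w -> w \in l -> w = head a l.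
    move=> wT Xaw wl; have := hang_tail hl wl aT; rewrite edge_sym Xaw => /(_ isT).
    by case/andP: ul => /negbTE -> _ /= /andP[/eqP].
  case: (leqP #|N| 1) => N1; last first.
    left; case/card_gt1P: N1 => z1 [z2 []]; rewrite !inE.
    case/and3P=> z1T X1 n1 /and3P[z2T X2 n2] z12.
    have na y : X a y -> y != a by apply: contraTneq => ->; rewrite Xaa.
    exists u, (rev (a :: l)), z1, z2; split; split=> //.
    - exact: hang_path hl.
    - by rewrite rev_uniq.
    - by move=> x; rewrite mem_rev; apply: sl.
    - by rewrite size_rev el q0.
    - by rewrite !mem_rev !inE (negbTE n1) (negbTE n2) !(negbTE (na _ _)).
    - by rewrite rev_cons last_rcons X1.
  case: (set_0Vmem N) => [N0|[w]].
    case: (whole a l hl sl) => w wT Xaw.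
    by apply: Nl => //; have /setP/(_ w) := N0; rewrite !inE wT Xaw /= => /negbFE.
  rewrite !inE => /and3P[wT Xaw wl].
  have wa : w != a by apply: contraTneq Xaw => ->; rewrite Xaa.
  right; exists (w :: a :: l); last by rewrite /= -el.
  split; last by move=> x; rewrite inE => /orP[/eqP ->|/sl].
    rewrite hang_cons2 edge_sym Xaw hl andbT /=; apply/forallP=> y.
    apply/implyP=> yT; apply/implyP=> Xay.
    case: (boolP (y \in l)) => yl.
      by have := Nl _ yT Xay yl; case: (l) yl => //= ? ? _ ->; rewrite eqxx orbT.
    have -> : y = w; last by rewrite eqxx.
    by apply: (card_le1_eqP N1); rewrite !inE ?yT ?wT ?Xay ?Xaw.
  by rewrite cons_uniq inE negb_or wa wl.
(* The full path with [m] vertices: its head [v1] lies deepest in [T], its last vertex [v] is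
   adjacent to [u]. *)
have [|?|[l [hl ul sl] el]] := step m; [by rewrite leqnn andbT ltnW|by left|].
case: l el hl ul sl => [|v1 l] el hl ul sl; first by rewrite -el in m2.
case/lastP: l el hl ul sl => [|s v] el hl ul sl; first by rewrite -el in m2.
have around a : a \in s ->
    exists l1 x y l2, v1 :: rcons s v = l1 ++ x :: a :: y :: l2.
  move=> as_; case/splitPr: as_ => s1 s2; case: (lastP s1) => [|s1' x]; case: s2 => [|y s2].
  - by exists [::], v1, v, [::].
  - by exists [::], v1, y, (rcons s2 v).
  - by exists (v1 :: s1'), x, v, [::]; rewrite cat_rcons rcons_cat.
  - by exists (v1 :: s1'), x, y, (rcons s2 v); rewrite cat_rcons rcons_cat.
have nbrs a l1 x y l2 : v1 :: rcons s v = l1 ++ x :: a :: y :: l2 ->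
    [/\ X a x, X a y, x != y & forall w, w \in T -> X a w -> w = x \/ w = y].
  move=> elx; have h : hang T u (x :: a :: y :: l2) by apply: (@hang_drop _ _ l1); rewrite -elx.
  have /= /and3P[Xxa Xay _] := hang_sorted h; split=> //; first by rewrite edge_sym.
    by move: ul; rewrite elx cat_uniq /= !inE !negb_or => /and3P[_ _ /andP[/and3P[_ -> _]]].
  move=> w wT Xaw; move: h; rewrite hang_cons2 => /andP[/andP[_ /forallP nb] _].
  by have := nb w; rewrite wT Xaw /= => /orP[]/eqP; [left|right].
(* An inner vertex with a neighbour outside [T] is itself a pendant path, its two neighbours on the
   path serving as [z1] and [z2]. *)
case: (boolP [exists a, exists w, [&& a \in s, w \notin T & X a w]]) => [|ins].
  case/existsP=> a /existsP[w /and3P[as_ wT Xaw]]; left.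
  have [l1 [x [y [l2 elx]]]] := around a as_.
  have [Xax Xay xy _] := nbrs _ _ _ _ _ elx.
  have aT : a \in T by apply: sl; rewrite elx mem_cat !inE eqxx !orbT.
  have xT : x \in T by apply: sl; rewrite elx mem_cat !inE eqxx !orbT.
  have yT : y \in T by apply: sl; rewrite elx mem_cat !inE eqxx !orbT.
  exists w, [:: a], x, y; split; split; rewrite //= ?andbT ?inE.
  - by rewrite edge_sym.
  - by move=> b; rewrite inE => /eqP ->.
  - apply/andP; split; first by apply: contraTneq Xax => ->; rewrite Xaa.
    by apply: contraTneq Xay => ->; rewrite Xaa.
  - by rewrite Xax.
(* Inner vertices now have degree 2. If all edges are cut edges, this is a bridge: [v1] has a second
   neighbour by [whole], and [v] has [u] besides its neighbour on the path. *)
case: (boolP (sorted (cut_edge X) (v1 :: rcons s v))) => [cut|ncut].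
  case: nbr; right; exists v1, s, v; split=> //.
    move=> a as_; have [l1 [x [y [l2 elx]]]] := around a as_.
    have [Xax Xay xy nax] := nbrs _ _ _ _ _ elx.
    rewrite /deg; have -> : [set w | X a w] = [set x; y].
      apply/setP=> w; rewrite !inE; apply/idP/orP=> [Xaw|[]/eqP -> //].
      have wT : w \in T.
        apply: contraR ins => wT; apply/existsP; exists a; apply/existsP; exists w.
        by rewrite as_ wT.
      by case: (nax w wT Xaw) => ->; rewrite eqxx; [left|right].
    by rewrite cards2 xy.
  split.
    have [] : exists2 w, X v1 w & w != head v1 (rcons s v).
      case: (boolP [exists w in T, X v1 w && (w != head v1 (rcons s v))]) => [|nw].
        by case/existsP=> w /and3P[_ ? ?]; exists w.
      case: (whole v1 (rcons s v) hl sl) => w wT Xw; apply/eqP; apply: contraR nw => nw.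
      by apply/existsP; exists w; rewrite wT Xw.
    move=> w Xw nw; apply: deg_neq1 Xw _ nw.
    by move: (hang_sorted hl); case: (s) => [|? ?] /= /andP[].
  have [x [l1 elx]] : exists x l1, v1 :: rcons s v = l1 ++ [:: x; v].
    case: (lastP s) => [|s' x]; first by exists v1, [::].
    by exists x, (v1 :: s'); rewrite -!cats1 -!catA.
  have xT : x \in T by apply: sl; rewrite elx mem_cat inE eqxx orbT.
  have hxv : hang T u [:: x; v] by apply: (@hang_drop _ _ l1); rewrite -elx.
  have /= /and3P[_ Xvu' _] := hxv.
  apply: (@deg_neq1 v x u) => //.
    by have /= := hang_sorted hxv; rewrite andbT edge_sym.
  by apply: contraTneq xT => ->.
(* Some edge [b c] of the path is not a cut edge. Within [T] the part from [c] on is joined to the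
   rest by this edge alone, so a connection avoiding it must leave [T] and return. *)
right.
have [l1 [b [c [l2 [elx Xbc ncbc]]]]] : exists l1 b c l2,
    [/\ v1 :: rcons s v = l1 ++ b :: c :: l2, X b c & ~~ cut_edge X b c].
  move: (hang_sorted hl) ncut; clear; elim: (rcons s v) v1 => // c l2 IH b.
  rewrite [sorted _ _]/= [sorted _ _]/= negb_and => /andP[Xbc pl] /orP[nc|/(IH c pl)].
    by exists [::], b, c, l2.
  by case=> l1 [b' [c' [l3 [-> ? ?]]]]; exists (b :: l1), b', c', l3.
have hbc : hang T u (b :: c :: l2) by apply: (@hang_drop _ _ l1); rewrite -elx.
have ubc : uniq (b :: c :: l2) by move: ul; rewrite elx cat_uniq => /and3P[].
apply: (@ear_from T [set x in c :: l2] c b (del_edge X b c)).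
- by move=> x y /and3P[].
- by apply/subsetP=> x; rewrite inE => xl; apply: sl; rewrite elx mem_cat inE xl !orbT.
- by rewrite !inE eqxx.
- by apply: sl; rewrite elx mem_cat !inE eqxx orbT.
- by rewrite inE; case/andP: ubc.
- rewrite (sym_connect_sym (del_edge_sym b c)); exact: not_cut_edge.
move=> x y; rewrite inE => xl yT; rewrite inE => yl; apply/negP=> /and3P[Xxy _ ne].
have := hang_tail hbc xl yT Xxy; rewrite (negbTE yl) /= => /andP[/eqP ex /eqP ey].
by rewrite ex ey eqxx in ne.
Qed.

End Structure.

(** * Growth from a claw *)

Section Growth.

Variables (V P : finType) (X : sgraph V) (Y : sgraph P).
Variables (beta : pred P) (Ybeta : forall u v, beta u != beta v -> Y u v).
Implicit Types (s : bijection V P) (T : {set V}).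

Variable E : bijection V P -> P -> P -> Prop.
Hypothesis E_refl : forall s u, E s u u.
Hypothesis E_sym : forall s u v, beta u -> beta v -> E s u v -> E s v u.
Hypothesis E_trans : forall s u v w, beta u -> beta v -> beta w ->
  E s u v -> E s v w -> E s u w.
Hypothesis E_move : forall s s' u v, beta u -> beta v ->
  connect (FS X Y) s s' -> E s u v -> E s' u v.

Local Notation black := (black beta).
Local Notation good := (good beta E).

Variables (v a b c : V).
Hypotheses (Xva : X v a) (Xvb : X v b) (Xvc : X v c) (abc : uniq [:: a; b; c]).
Hypothesis claw_E : forall s x y, x \in [:: v; a; b; c] -> y \in [:: v; a; b; c] ->
  x != y -> beta (s x) -> beta (s y) ->
  (forall z, z \in [:: v; a; b; c] -> z != x -> z != y -> ~~ beta (s z)) ->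
  E s (s x) (s y).

Lemma claw_uniq : uniq [:: v; a; b; c].
Proof.
rewrite cons_uniq abc andbT !inE !negb_or.
by apply/and3P; split; [move: Xva|move: Xvb|move: Xvc]; apply: contraTneq => <-;
  rewrite edge_irr.
Qed.

Lemma card_white s : #|~: black s| = #|[set u | ~~ beta u]|.
Proof.
rewrite -(card_imset _ (@bijI _ _ s)); apply: eq_card => u; rewrite inE.
apply/imsetP/idP => [[x]|bu]; first by rewrite !inE => ? ->.
by exists (bij_inv s u); rewrite ?inE bij_invK.
Qed.

(** At least two whites in the claw leave at most two blacks on its four vertices, so both cases of
    [fit] reduce to [claw_E]. *)
Lemma claw_good : 2 <= #|[set u | ~~ beta u]| -> good [set x in [:: v; a; b; c]].
Proof.
move=> m2 s fs x y; case: (eqVneq x y) => [->//|xy].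
rewrite !in_setI ![_ \in black s]inE ![_ \in [set x in _]]inE => /andP[bx xS] /andP[by_ yS].
apply: claw_E => // z zS zx zy; apply/negP=> bz.
set S := [set x in _] in fs.
have cS : #|S| = 4 by rewrite cardsE; apply/card_uniqP/claw_uniq.
have sub3 : [set x; y; z] \subset black s :&: S.
  apply/subsetP=> w wxyz; have [wS bw] : w \in [:: v; a; b; c] /\ beta (s w).
    by case/setUP: wxyz => [/set2P[]|/set1P] ->.
  by apply/setIP; rewrite ![_ \in S]inE [_ \in black s]inE.
have c3 : #|[set x; y; z]| = 3.
  by rewrite setUC cardsU1 cards2 !inE negb_or zx zy xy.
have := subset_leq_card sub3; rewrite c3; case/orP: fs => [n2|wS].
  by move/leq_trans => /(_ _ n2).
have := cardsID (black s) S; rewrite setIC cS.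
have -> : S :\: black s = ~: black s by rewrite setDE; apply/setIidPr.
by rewrite (card_white s) => e h3; have := leq_add h3 m2; rewrite e.
Qed.

(** A good set is enlarged from the claw up to all of [X], where every configuration is fit. *)
Lemma growth m : 2 <= m <= #|[set u | ~~ beta u]| -> connected X ->
  ~ has_bridge X m -> forall s u w, beta u -> beta w -> E s u w.
Proof.
case/andP=> m2 mW cX nbr s u w bu bw.
suff gV : good setT.
  rewrite -(bij_invK s u) -(bij_invK s w); apply: gV; rewrite ?inE ?bij_invK ?bu ?bw //.
  by apply/orP; right; apply: subsetT.
set W := #|_| in mW.
pose S := [set x in [:: v; a; b; c]].
have Sv3 : 2 < #|[set w in S | X v w]|.
  have -> : 3 = #|[set x in [:: a; b; c]]| by rewrite cardsE; apply/esym/card_uniqP.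
  apply/subset_leq_card/subsetP=> x; rewrite !inE.
  by case/or3P=> /eqP ->; rewrite eqxx ?Xva ?Xvb ?Xvc ?orbT.
have cS : conn X S.
  have -> : S = [set v] :|: [set x in [:: a]] :|: [set x in [:: b]] :|: [set x in [:: c]].
    by apply/setP=> x; rewrite !inE !orbA.
  have c1 : conn X [set v] by move=> i j; rewrite !inE => /eqP -> /eqP ->.
  have add T x : conn X T -> v \in T -> X v x -> conn X (T :|: [set y in [:: x]]).
    by move=> cT vT Xvx; apply: conn_add_path vT _; rewrite //= Xvx.
  have c2 := add _ _ c1 (set11 v) Xva.
  have c3 := add _ _ c2 (setU11 _ _) Xvb.
  by apply: add c3 _ Xvc; rewrite !inE eqxx.
suff gen n T : #|~: T| < n -> S \subset T -> conn X T -> good T -> good setT.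
  by apply: (gen _ S (ltnSn _)) => //; apply: claw_good; apply: leq_trans mW.
elim: n T => // n IH T Tn sST cT gT.
have vT : v \in T by apply: (subsetP sST); rewrite !inE eqxx.
have T3 : 3 < #|T|.
  apply: leq_trans (subset_leq_card sST).
  by rewrite cardsE (card_uniqP claw_uniq).
case: (eqVneq T setT) => [<-//|TT].
have Tv3 : 2 < #|[set w in T | X v w]|.
  apply: leq_trans Sv3 _; apply/subset_leq_card/subsetP=> x; rewrite !inE => /andP[xS ->].
  by rewrite andbT; apply: (subsetP sST); rewrite !inE.
have smaller T' : T \proper T' -> #|~: T'| < n.
  by move=> pT; rewrite ltnS in Tn; apply: leq_trans Tn; apply: proper_card; rewrite properC.
case: (extend_exists m2 cX nbr cT TT vT Tv3).
  case=> x [p [z1 [z2 [[xT pp up sp /andP[p0 pm]] [z1T z2T z12 /andP[n1 n2] /andP[X1 X2]]]]]].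
  apply: (IH (x |: T)).
  - by apply: smaller; rewrite properUr // sub1set.
  - by apply: subset_trans sST (subsetUr _ _).
  - case: p p0 pp sp {up n1 n2 X1 X2 pm} => // y p _ /= /andP[Xxy _] sp.
    by apply: (@conn_add _ _ _ y); rewrite // 1?edge_sym // sp ?inE ?eqxx.
  (* The count of whites is exact there, hence [W] in place of [m]; paths shorter than [m] are
     shorter than [W]. *)
  - apply: (extend_pendant Ybeta E_sym E_trans E_move
             (p := p) (z1 := z1) (z2 := z2) (m := W)) => //.
    + by apply: ltn_trans T3.
    + by rewrite p0 (leq_trans pm).
    + by move=> s0; rewrite card_white.
case=> x [es [y [[xT yT xy sesT [ues pes]] es0]]].
apply: (IH (T :|: [set z in es])).
- apply: smaller; rewrite properUl //; case: es es0 sesT {ues pes} => // z es _ sesT.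
  apply/subsetPn; exists z; first by rewrite !inE eqxx.
  by have := sesT z; rewrite !inE eqxx => /(_ isT).
- by apply: subset_trans sST (subsetUl _ _).
- by apply: (@conn_add_path _ _ _ x) => //; move: pes; rewrite rcons_path => /andP[].
apply: (extend_ear Ybeta E_sym E_trans E_move (v := x) (b := y)) => //; first by apply: ltnW.
by move=> s0; rewrite card_white -/W; apply: leq_trans mW; apply: ltnW.
Qed.

End Growth.

(** * Exchanges inside a claw *)

Section Colours.

Variables (V P : finType) (X : sgraph V) (Y : sgraph P).
Variables (C : eqType) (col : P -> C).
Hypothesis Ycol : forall u v, Y u v = (col u != col v).
Implicit Types (s : bijection V P) (T : {set V}) (g h : {perm P}).

(** Friendship depends on colours only, so colour-preserving permutations of the tokens act as
    automorphisms of the friends-and-strangers graph. *)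
Lemma pact_connect g s s' : (forall u, col (g u) = col u) ->
  connect (FS X Y) s s' -> connect (FS X Y) (pact g s) (pact g s').
Proof.
move=> gcol /connectP[p]; elim: p s => [|s1 p IH] s /=; first by move=> _ ->.
case/andP=> ss1 pp es; apply: connect_trans (IH s1 pp es); apply: connect1.
case/existsP: ss1 => a /existsP[b /and5P[Xab Yab /eqP sa /eqP sb /forallP sc]].
apply/existsP; exists a; apply/existsP; exists b; rewrite Xab Ycol !pactE !gcol -Ycol Yab.
rewrite sa sb !eqxx /=; apply/forallP=> c; apply/implyP=> ca; apply/implyP=> cb.
by rewrite !pactE; have := sc c; rewrite ca cb /= => /eqP ->.
Qed.

Lemma col_tperm i j u : col i = col j -> col (tperm i j u) = col u.
Proof. by move=> cij; case: tpermP => // ->. Qed.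

(** The attainable colour-preserving permutations; they form a group that is the same for all
    configurations in one component. *)
Definition inG s g := (forall u, col (g u) = col u) /\ connect (FS X Y) s (pact g s).

Lemma inG1 s : inG s 1.
Proof. by split=> [u|]; rewrite ?perm1 ?pact1. Qed.

Lemma inGM s g h : inG s g -> inG s h -> inG s (g * h).
Proof.
move=> [gc cg] [hc ch]; split=> [u|]; first by rewrite permM hc gc.
by rewrite pactM; apply: connect_trans ch _; apply: pact_connect.
Qed.

Lemma inGV s g : inG s g -> inG s g^-1.
Proof.
move=> [gc cg]; have gVc u : col (g^-1 u)%g = col u by rewrite -[in RHS](permKV g u) gc.
split=> //; have := pact_connect gVc cg.
by rewrite -pactM mulgV pact1 FSC.
Qed.

Lemma inGJ s g h : inG s g -> inG s h -> inG s (g ^ h).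
Proof. by move=> Gg Gh; apply: inGM; [apply: inGV | apply: inGM]. Qed.

Lemma inG_move s s' g : connect (FS X Y) s s' -> inG s g -> inG s' g.
Proof.
move=> c [gc cg]; split=> //; apply: (@connect_trans _ _ s); first by rewrite FSC.
by apply: connect_trans cg _; apply: pact_connect.
Qed.

Section Claw.

Variables (v a b c : V).
Hypotheses (Xva : X v a) (Xvb : X v b) (Xvc : X v c) (abc : uniq [:: a; b; c]).

Definition placed s0 s k l i j :=
  [/\ connect (FS X Y) s0 s, forall x, x \notin [:: v; a; b; c] -> s x = s0 x
    & [/\ s v = k, s a = l, s b = i & s c = j]].

Let neq : [/\ v != a, v != b & v != c] /\ [/\ a != b, a != c & b != c].
Proof.
have := claw_uniq Xva Xvb Xvc abc; rewrite /= !inE !negb_or.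
by case/and4P=> /and3P[-> -> ->] /andP[-> ->] -> _.
Qed.

Let offS (q x : V) : q \in [:: v; a; b; c] -> x \notin [:: v; a; b; c] -> q != x.
Proof. by move=> qS; apply: contraNneq => <-. Qed.

Lemma placed_a s0 s k l i j : Y k l -> placed s0 s k l i j ->
  exists s', placed s0 s' l k i j.
Proof.
have [[va vb vc] [ab ac bc]] := neq.
move=> Ykl [cs os [sv sa sb sc]]; exists (sw v a s); split.
- by apply: connect_trans cs _; apply: connect_sw => //; rewrite sv sa.
- by move=> x xS; rewrite swE tpermD ?os // offS // !inE eqxx ?orbT.
- by rewrite !swE tpermL tpermR !tpermD.
Qed.

Lemma placed_b s0 s k l i j : Y k i -> placed s0 s k l i j ->
  exists s', placed s0 s' i l k j.
Proof.
have [[va vb vc] [ab ac bc]] := neq.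
move=> Ykl [cs os [sv sa sb sc]]; exists (sw v b s); split.
- by apply: connect_trans cs _; apply: connect_sw => //; rewrite sv sb.
- by move=> x xS; rewrite swE tpermD ?os // offS // !inE eqxx ?orbT.
- by rewrite !swE tpermL tpermR !tpermD // eq_sym.
Qed.

Lemma placed_c s0 s k l i j : Y k j -> placed s0 s k l i j ->
  exists s', placed s0 s' j l i k.
Proof.
have [[va vb vc] [ab ac bc]] := neq.
move=> Ykl [cs os [sv sa sb sc]]; exists (sw v c s); split.
- by apply: connect_trans cs _; apply: connect_sw => //; rewrite sv sc.
- by move=> x xS; rewrite swE tpermD ?os // offS // !inE eqxx ?orbT.
- by rewrite !swE tpermL tpermR !tpermD // eq_sym.
Qed.

Lemma placed_pact s0 s k l i j g : placed s0 s0 k l i j ->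
  placed s0 s (g k) (g l) (g i) (g j) ->
  (forall u, u \notin [:: k; l; i; j] -> g u = u) -> s = pact g s0.
Proof.
move=> [_ _ [<- <- <- <-]] [_ os [sv sa sb sc]] og; apply: bij_ext => x; rewrite pactE.
case: (boolP (x \in [:: v; a; b; c])) => [|xS]; last first.
  by rewrite os // og // -(map_cons s0 c [::]) -!map_cons mem_map //; apply: bijI.
by rewrite !inE => /or4P[] /eqP ->.
Qed.

(** Six swaps through the centre, using the leaves [b], [a], [c] cyclically. With two colours on the
    claw each swap changes the colour at the centre, so a return takes an even number of swaps and a
    single transposition is impossible. *)
Lemma claw_double s k l i j : placed s s k l i j -> col i = col j -> col k = col l ->
  col i != col k -> inG s (tperm i j * tperm k l).
Proof.
move=> p0 cij ckl cik.
have [Yki Ylj Ykj Yli] : [/\ Y k i, Y l j, Y k j & Y l i].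
  by rewrite !Ycol -ckl -cij eq_sym cik.
have [Yik Yjl Yjk Yil] : [/\ Y i k, Y j l, Y j k & Y i l].
  by rewrite !(edge_sym Y _ k) !(edge_sym Y _ l).
have [s1 p1] := placed_b Yki p0; have [s2 p2] := placed_a Yil p1.
have [s3 p3] := placed_c Ylj p2; have [s4 p4] := placed_b Yjk p3.
have [s5 p5] := placed_a Yki p4; have [s6 p6] := placed_c Yil p5.
have nki : [/\ k != i, k != j, l != i & l != j].
  by split; [move: Yki|move: Ykj|move: Yli|move: Ylj]; apply: contraTneq => ->; rewrite edge_irr.
have [ki kj li lj] := nki.
have [ik jk il jl] : [/\ i != k, j != k, i != l & j != l] by split; rewrite eq_sym.
split=> [u|].
  by rewrite permM !col_tperm.
suff <- : s6 = pact (tperm i j * tperm k l) s by case: p6.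
apply: (placed_pact p0).
  have -> : (tperm i j * tperm k l)%g k = l by rewrite permM (tpermD ik jk) tpermL.
  have -> : (tperm i j * tperm k l)%g l = k by rewrite permM (tpermD il jl) tpermR.
  have -> : (tperm i j * tperm k l)%g i = j by rewrite permM tpermL (tpermD kj lj).
  by have -> : (tperm i j * tperm k l)%g j = i by rewrite permM tpermR (tpermD ki li).
move=> u; rewrite !inE !negb_or => /and4P[uk ul ui uj].
by rewrite permM !tpermD // eq_sym.
Qed.

(** Now [k] and [l] may be swapped with each other as well, which allows a return after nine
    swaps. *)
Lemma claw_single s k l i j : placed s s k l i j -> col i = col j -> col k != col l ->
  col i != col k -> col i != col l -> inG s (tperm i j).
Proof.
move=> p0 cij ckl cik cil.
have [Yki Ylj Ykj Yli] : [/\ Y k i, Y l j, Y k j & Y l i].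
  by rewrite !Ycol -cij ![_ == col i]eq_sym cik cil.
have Ykl : Y k l by rewrite Ycol.
have Ylk : Y l k by rewrite edge_sym.
have [Yik Yjl Yjk Yil] : [/\ Y i k, Y j l, Y j k & Y i l].
  by rewrite !(edge_sym Y _ k) !(edge_sym Y _ l).
have [s1 p1] := placed_b Yki p0; have [s2 p2] := placed_a Yil p1.
have [s3 p3] := placed_b Ylk p2; have [s4 p4] := placed_c Ykj p3.
have [s5 p5] := placed_b Yjl p4; have [s6 p6] := placed_c Ylk p5.
have [s7 p7] := placed_a Yki p6; have [s8 p8] := placed_c Yil p7.
have [s9 p9] := placed_a Ylk p8.
have nki : [/\ k != i, k != j, l != i & l != j].
  by split; [move: Yki|move: Ykj|move: Yli|move: Ylj]; apply: contraTneq => ->; rewrite edge_irr.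
have [ki kj li lj] := nki.
have [ik jk il jl] : [/\ i != k, j != k, i != l & j != l] by split; rewrite eq_sym.
split=> [u|]; first exact: col_tperm.
suff <- : s9 = pact (tperm i j) s by case: p9.
apply: (placed_pact p0).
  by rewrite tpermL tpermR !tpermD.
move=> u; rewrite !inE !negb_or => /and4P[uk ul ui uj].
by rewrite tpermD // eq_sym.
Qed.

End Claw.

End Colours.

(** * Bringing tokens into position on the claw *)

Lemma first_hit (V : finType) (X : sgraph V) (S : {set V}) p v :
  connected X -> p \notin S -> v \in S -> exists q r,
    [/\ q \notin S, r \in S, X q r & connect (inside X (~: S)) p q].
Proof.
move=> cX pS vS; case/connectP: (cX p v) => l; elim: l p pS => [|y l IH] p pS /=.
  by move=> _ vp; rewrite -vp vS in pS.
case/andP=> Xpy pl el; case: (boolP (y \in S)) => yS; first by exists p, y.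
have [q [r [qS rS Xqr cyq]]] := IH y yS pl el.
exists q, r; split=> //; apply: connect_trans cyq; apply: connect1.
by rewrite /inside Xpy !inE pS.
Qed.

Section Arrange.

Variables (V P : finType) (X : sgraph V) (Y : sgraph P).
Variables (C : eqType) (col : P -> C).
Hypothesis Ycol : forall u v, Y u v = (col u != col v).
Implicit Types (s : bijection V P).

Variables (v a b c : V).
Hypotheses (Xva : X v a) (Xvb : X v b) (Xvc : X v c) (abc : uniq [:: a; b; c]).
Local Notation S := [:: v; a; b; c].

Variable c0 : C.
Local Notation beta := (fun u => col u == c0).

Lemma class_adjacent u w : beta u != beta w -> Y u w.
Proof. by rewrite Ycol; apply: contraNneq => ->. Qed.

Lemma conn_claw : conn X [set z in S].
Proof.
have H z : z \in [set z in S] -> connect (inside X [set z in S]) v z.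
  rewrite !inE => zS; case: (eqVneq z v) => [->|zv]; first exact: connect0.
  apply: connect1; rewrite /inside !inE eqxx /= zS andbT.
  by move: zS; rewrite (negbTE zv) /= => /or3P[] /eqP ->.
move=> y z /H vy /H vz; apply: connect_trans vz; by rewrite insideC.
Qed.

(** Blacks go to the leaves [b] and [c]. The set of tokens on the claw does not change, which
    identifies [i] and [j] with the two original blacks. *)
Lemma arrange s x y : x \in S -> y \in S -> x != y -> beta (s x) -> beta (s y) ->
  (forall z, z \in S -> z != x -> z != y -> ~~ beta (s z)) ->
  exists s1 k l i j, [/\ connect (FS X Y) s s1, placed X Y v a b c s1 s1 k l i j,
    [&& ~~ beta k, ~~ beta l, beta i & beta j]
    & forall z, z \in S -> s z \in [:: k; l; i; j]].
Proof.
move=> xS yS xy bx by_ wS.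
have /= /and4P[va ab bc _] := claw_uniq Xva Xvb Xvc abc.
rewrite !inE !negb_or in va ab bc; have [/and3P[va' vb vc] /andP[ab' ac]] := (va, ab).
have cD : #|[set b; c]| = #|black beta s :&: [set z in S]|.
  have -> : black beta s :&: [set z in S] = [set x; y].
    apply/setP=> z; rewrite 3!inE in_set2; apply/andP/idP=> [[bz zS]|/orP[]/eqP -> //].
    by apply: contraLR bz; rewrite negb_or => /andP[zx zy]; apply: wS.
  by rewrite !cards2 xy bc.
have sD : [set b; c] \subset [set z in S].
  by apply/subsetP=> z; rewrite in_set2 !inE => /orP[]/eqP ->; rewrite eqxx ?orbT.
have [s1 r1 e1] := pattern class_adjacent conn_claw sD cD.
have col1 z : z \in S -> beta (s1 z) = (z \in [set b; c]).
  by move=> zS; rewrite -e1 in_setI !(in_set (fun z => z \in S)) zS andbT inE.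
exists s1, (s1 v), (s1 a), (s1 b), (s1 c); split.
- by case: r1.
- by split.
- rewrite !col1 ?inE ?eqxx ?orbT // !negb_or.
  by rewrite vb vc ab' ac.
move=> z zS; have [|w wS1 <-] := @reach_pos _ _ _ _ _ _ _ z r1; first by rewrite inE.
by rewrite inE in wS1; apply: (map_f s1 wS1).
Qed.

Lemma arranged_tperm s s1 x y k l i j :
  x \in S -> y \in S -> x != y -> beta (s x) -> beta (s y) ->
  [&& ~~ beta k, ~~ beta l, beta i & beta j] ->
  (forall z, z \in S -> s z \in [:: k; l; i; j]) ->
  placed X Y v a b c s1 s1 k l i j ->
  tperm (s x) (s y) = tperm i j.
Proof.
move=> xS yS xy bx by_ /and4P[bk bl bi bj] h _.
have hb z : z \in S -> beta (s z) -> s z = i \/ s z = j.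
  move=> zS bz; have := h z zS; rewrite !inE => /or4P[]/eqP e; rewrite e in bz *.
  - by rewrite bz in bk.
  - by rewrite bz in bl.
  - by left.
  - by right.
have sxy : s x != s y by rewrite (inj_eq (@bijI _ _ s)).
case: (hb x xS bx) => ex; case: (hb y yS by_) => ey; rewrite ex ey ?eqxx // in sxy *.
by rewrite tpermC.
Qed.

(** If both whites on the claw have the same colour, one of them is replaced by a token of a third
    colour from outside; then [claw_single] applies. *)
Lemma three_colours :
  connected X -> (forall c1, exists z, col z != c0 /\ col z != c1) ->
  forall s x y, x \in S -> y \in S -> x != y -> beta (s x) -> beta (s y) ->
  (forall z, z \in S -> z != x -> z != y -> ~~ beta (s z)) ->
  inG X Y col s (tperm (s x) (s y)).
Proof.
move=> cX c3.
have claw s1 k l i j : placed X Y v a b c s1 s1 k l i j ->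
    [&& ~~ beta k, ~~ beta l, beta i & beta j] -> col k != col l ->
    inG X Y col s1 (tperm i j).
  move=> pl /and4P[bk bl /eqP bi /eqP bj] kl.
  apply: (claw_single Ycol Xva Xvb Xvc abc pl); rewrite ?bi ?bj //.
    by rewrite eq_sym.
  by rewrite eq_sym.
move=> s x y xS yS xy bx by_ wS.
have [s1 [k [l [i [j [cs1 pl cl h]]]]]] := arrange xS yS xy bx by_ wS.
have FSsym := FSC X Y.
apply: (inG_move Ycol (s := s1)); rewrite ?(arranged_tperm _ _ _ _ _ cl h pl) //.
  by rewrite FSsym.
case: (eqVneq (col k) (col l)) => [kl|]; last exact: claw.
have [z [zc0 zck]] := c3 (col k).
have /and4P[bk bl bi bj] := cl; have [_ _ [s1v s1a s1b s1c]] := pl.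
pose SS := [set z in S].
have pS : bij_inv s1 z \notin SS.
  apply/negP; rewrite inE => pS; have := bij_invK s1 z.
  move: pS; rewrite !inE => /or4P[]/eqP ->; rewrite ?s1v ?s1a ?s1b ?s1c => e.
  - by rewrite -e eqxx in zck.
  - by rewrite -e -kl eqxx in zck.
  - by rewrite -e bi in zc0.
  - by rewrite -e bj in zc0.
have vS : v \in SS by rewrite !inE eqxx.
have [q [r [qS rS Xqr cpq]]] := first_hit cX pS vS.
(* Recolouring is done for the colour of [z] against all others; any token of that colour will
   do. *)
have Yz u w : (col u == col z) != (col w == col z) -> Y u w.
  by rewrite Ycol; apply: contraNneq => ->.
have [s2 [cs2 o2] e2] := recolor Yz s1 cpq.
have s2q : col (s2 q) = col z by apply/eqP; rewrite e2 tpermR bij_invK eqxx.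
have s2S t : t \in SS -> s2 t = s1 t by move=> tS; apply: o2; rewrite inE negbK.
have [[va vb vc] [ab ac bc]] : [/\ v != a, v != b & v != c] /\ [/\ a != b, a != c & b != c].
  have := claw_uniq Xva Xvb Xvc abc; rewrite /= !inE !negb_or.
  by case/and4P=> /and3P[-> -> ->] /andP[-> ->] -> _.
have [aS bS cS] : [/\ a \in SS, b \in SS & c \in SS] by rewrite !inE !eqxx !orbT.
(* The entry vertex [r] has to carry a white, so that the swap with [q] keeps both blacks on the
   claw. *)
have [s3 r3 w3] : exists2 s3, reach X Y SS s2 s3 & ~~ beta (s3 r).
  case: (boolP (beta (s2 r))) => br; last by exists s2.
  have [s3 r3 e3] := recolor class_adjacent s2 (conn_claw vS rS).
  by exists s3 => //; rewrite e3 tpermR s2S // s1v.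
have [i' iS ei] : exists2 i', i' \in SS & s3 i' = i.
  by have [i' iS ei] := reach_pos r3 bS; exists i' => //; rewrite ei s2S.
have [j' jS ej] : exists2 j', j' \in SS & s3 j' = j.
  by have [j' jS ej] := reach_pos r3 cS; exists j' => //; rewrite ej s2S.
have s3q : s3 q = s2 q by case: r3 => _; apply.
have qi t : t \in SS -> q != t by move=> tS; apply: contraNneq qS => ->.
have s3S t : t \in SS -> [|| s3 t == k, s3 t == l, s3 t == i | s3 t == j].
  move=> tS; have [cs3 o3] := r3.
  have r32 : reach X Y SS s3 s2 by split=> [|y0 /o3 //]; rewrite FSsym.
  have [w wS' <-] := reach_pos r32 tS.
  rewrite s2S //; move: wS'; rewrite !inE.
  by case/or4P=> /eqP ->; rewrite ?s1v ?s1a ?s1b ?s1c eqxx ?orbT.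
have r_wh : s3 r = k \/ s3 r = l.
  case/or4P: (s3S r rS) => /eqP e; [by left|by right| |]; by rewrite e ?bi ?bj in w3.
have colr : col (s3 r) = col k by case: r_wh => ->.
pose s4 := sw q r s3.
have c34 : connect (FS X Y) s3 s4.
  by apply: connect_sw => //; rewrite Ycol s3q s2q colr.
have s4S t : t \in SS -> t != r -> s4 t = s3 t.
  by move=> tS tr; rewrite /s4 swE tpermD ?qi // eq_sym.
have s4r : col (s4 r) = col z by rewrite /s4 swE tpermR s3q.
have ri : i' != r by apply: contraNneq w3 => <-; rewrite ei.
have rj : j' != r by apply: contraNneq w3 => <-; rewrite ej.
have ij : i' != j'.
  have : i != j by rewrite -s1b -s1c (inj_eq (@bijI _ _ s1)).
  by apply: contraNneq => e; rewrite -ei -ej e.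
have si : s4 i' = i by rewrite s4S.
have sj : s4 j' = j by rewrite s4S.
have w4 t : t \in S -> t != i' -> t != j' -> ~~ beta (s4 t).
  move=> tS ti tj; case: (eqVneq t r) => [->|tr]; first by rewrite s4r.
  have tSS : t \in SS by rewrite inE.
  rewrite s4S //; case/or4P: (s3S t tSS) => /eqP e; rewrite e //.
    by rewrite -ei in e; rewrite (bijI e) eqxx in ti.
  by rewrite -ej in e; rewrite (bijI e) eqxx in tj.
have iS' : i' \in S by rewrite inE in iS.
have jS' : j' \in S by rewrite inE in jS.
have b4i : beta (s4 i') by rewrite si.
have b4j : beta (s4 j') by rewrite sj.
have [s5 [k5 [l5 [i5 [j5 [cs5 pl5 cl5 h5]]]]]] := arrange iS' jS' ij b4i b4j w4.
have := arranged_tperm iS' jS' ij b4i b4j cl5 h5 pl5; rewrite si sj => ->.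
apply: (inG_move Ycol (s := s5)).
  rewrite FSsym; apply: connect_trans cs2 _; apply: (@connect_trans _ _ s3).
    by case: r3.
  by apply: connect_trans cs5.
apply: (claw _ _ _ _ _ pl5 cl5); apply/eqP=> kl5.
(* The remaining vertex [t] carries colour [col k] and [r] carries [col z], so equal colours of [k5]
   and [l5] are contradictory. *)
have [t [tS tr ti tj]] : exists t, [/\ t \in SS, t != r, t != i' & t != j'].
  have : ~~ (S \subset [:: r; i'; j']).
    apply/negP=> /subset_leq_card; rewrite (card_uniqP (claw_uniq Xva Xvb Xvc abc)).
    by move/leq_trans/(_ (card_size _)).
  case/subsetPn=> t tS; rewrite !inE !negb_or => /and3P[tr ti tj].
  by exists t; rewrite inE.
have wcol t' : t' \in S -> ~~ beta (s4 t') -> col (s4 t') = col k5.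
  move=> tS' wt; have /and4P[_ _ bi5 bj5] := cl5.
  have := h5 t' tS'; rewrite !inE => /or4P[]/eqP e; rewrite e // in wt *.
    by rewrite bi5 in wt.
  by rewrite bj5 in wt.
have tS' : t \in S by rewrite inE in tS.
have rS' : r \in S by rewrite inE in rS.
have e1 := wcol t tS' (w4 t tS' ti tj).
have e2' : col (s4 r) = col k5 by apply: wcol => //; rewrite s4r.
have ct : col (s4 t) = col k.
  have wt := w4 t tS' ti tj; rewrite s4S // in wt *.
  case/or4P: (s3S t tS) => /eqP e; rewrite e // in wt *; by rewrite ?bi ?bj in wt.
by move: zck; rewrite -s4r e2' -e1 ct eqxx.
Qed.

End Arrange.

(** * Two classes *)

Section Perms.

Variables (P : finType) (D : pred P).
Implicit Types (g h : {perm P}).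
Local Open Scope group_scope.

Definition fixes g := forall u, D u -> g u = u.

Lemma fixes_stable g a : fixes g -> D (g a) = D a.
Proof.
move=> fg; apply/idP/idP=> [Dga|Da]; last by rewrite fg.
by have /perm_inj e := fg _ Dga; rewrite e in Dga.
Qed.

(** The factor [tperm (g u) u] makes [u] a fixed point and spoils none in [D], so fewer points of
    [D] are moved; [w] allows side effects off [D]. *)
Lemma perm_supp_ind (H : {perm P} -> Prop) :
  (forall g, fixes g -> H g) ->
  (forall g u, D u -> D (g u) -> g u != u -> (forall x, D (g x) = D x) ->
     exists2 w, fixes w & H (g * (tperm (g u) u * w)) -> H g) ->
  forall g, (forall x, D (g x) = D x) -> H g.
Proof.
move=> H0 H1 g; move: {2}_.+1 (ltnSn #|[set u | D u & g u != u]|) => n.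
elim: n g => // n IH g ltn gD.
case: (set_0Vmem [set u | D u & g u != u]) => [e0|[u]].
  apply: H0 => u Du; have /setP/(_ u) := e0; rewrite !inE Du /=.
  by move/negbFE/eqP.
rewrite inE => /andP[Du gu]; have Dgu : D (g u) by rewrite gD.
have [w fw] := H1 g u Du Dgu gu gD; apply.
have tD x : D (tperm (g u) u x) = D x by case: tpermP => // ->; rewrite ?Dgu ?Du.
apply: IH => [|x]; last by rewrite !permM fixes_stable // tD gD.
rewrite ltnS in ltn; apply: leq_trans ltn; apply: proper_card; apply/properP; split.
  apply/subsetP=> x; rewrite !inE => /andP[Dx]; rewrite Dx /=; apply: contraNneq => gx.
  rewrite !permM gx; case: tpermP => [xgu|xu|_ _].
  - have /perm_inj e : g (g u) = g u by rewrite -xgu.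
    by rewrite e eqxx in gu.
  - by rewrite -xu gx eqxx in gu.
  - by rewrite fw.
exists u; first by rewrite inE Du.
by rewrite inE !permM tpermL fw ?Du // eqxx.
Qed.

End Perms.

(** * Normal subgroups containing an odd permutation *)

Section Normal.

Variables (P : finType) (D : pred P).
Implicit Types (g h : {perm P}).
Local Open Scope group_scope.
Local Notation fixes := (fixes D).

(** Once nonempty, a normal subgroup of the symmetric group off [D]; conjugation by transpositions
    suffices, as they generate that group. *)
Variable N : {perm P} -> Prop.
Hypothesis N_M : forall g h, N g -> N h -> N (g * h).
Hypothesis N_V : forall g, N g -> N g^-1.
Hypothesis N_fix : forall g, N g -> fixes g.
Hypothesis N_J : forall g a b, N g -> ~~ D a -> ~~ D b -> N (g ^ tperm a b).

Lemma N_D g a : N g -> D (g a) = D a.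
Proof. by move/N_fix/fixes_stable. Qed.

(** The product is the commutator of [g] with [tperm a b]. *)
Lemma N_comm g a b : N g -> ~~ D a -> ~~ D b -> N (tperm (g a) (g b) * tperm a b).
Proof.
move=> Ng Da Db; rewrite -tpermJ.
have -> : tperm a b ^ g * tperm a b = g^-1 * g ^ tperm a b.
  by rewrite /conjg tpermV !mulgA.
by apply: N_M; [apply: N_V|apply: N_J].
Qed.

Definition three_cycle := exists x y z,
  [/\ ~~ D x, ~~ D y, ~~ D z, uniq [:: x; y; z] & N (tperm x y * tperm x z)].

(** Three successive conjugations by transpositions move the points of the given 3-cycle to [a], [b]
    and [c]. *)
Lemma three_cycles a b c : three_cycle -> ~~ D a -> ~~ D b -> ~~ D c ->
  uniq [:: a; b; c] -> N (tperm a b * tperm a c).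
Proof.
move=> [x [y [z [Dx Dy Dz uxyz Nxyz]]]] Da Db Dc uabc.
have J u v x1 y1 z1 : ~~ D u -> ~~ D v -> N (tperm x1 y1 * tperm x1 z1) ->
    N (tperm (tperm u v x1) (tperm u v y1) * tperm (tperm u v x1) (tperm u v z1)).
  by move=> Du Dv Nt; rewrite -!tpermJ -conjMg; apply: N_J.
have Dt u v w : ~~ D u -> ~~ D v -> ~~ D w -> ~~ D (tperm u v w).
  by move=> Du Dv Dw; case: tpermP.
have U u v (s : seq P) : uniq s -> uniq (map (tperm u v) s).
  by rewrite map_inj_uniq //; apply: perm_inj.
have {}Nxyz := J x a _ _ _ Dx Da Nxyz; have {}uxyz := U x a [:: x; y; z] uxyz.
rewrite /= tpermL in Nxyz uxyz.
have [Dy' Dz'] := (Dt x a y Dx Da Dy, Dt x a z Dx Da Dz).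
move: (tperm x a y) (tperm x a z) Dy' Dz' Nxyz uxyz => {Dy Dz}y {}z Dy Dz Nxyz uxyz.
have [ab [ac bc]] : a != b /\ a != c /\ b != c.
  by move: uabc; rewrite /= !inE negb_or andbT => /andP[/andP[]].
have ay : a != y by move: uxyz; rewrite /= !inE negb_or => /andP[/andP[]].
have {}Nxyz := J y b _ _ _ Dy Db Nxyz; have {}uxyz := U y b [:: a; y; z] uxyz.
have ya : tperm y b a = a by rewrite tpermD // eq_sym.
rewrite /= tpermL ya in Nxyz uxyz.
have Dz' := Dt y b z Dy Db Dz.
move: (tperm y b z) Dz' Nxyz uxyz => {Dz}z Dz Nxyz uxyz.
have [az bz] : a != z /\ b != z.
  by move: uxyz; rewrite /= !inE negb_or andbT => /andP[/andP[_ ->] ->].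
have := J z c _ _ _ Dz Dc Nxyz; rewrite tpermL.
have -> : tperm z c a = a by rewrite tpermD // eq_sym.
by have -> : tperm z c b = b by rewrite tpermD // eq_sym.
Qed.

Lemma N1 h : N h -> N 1.
Proof. by move=> Nh; rewrite -(mulgV h); apply: N_M Nh (N_V Nh). Qed.

Lemma even_products a b c d : three_cycle -> ~~ D a -> ~~ D b -> ~~ D c -> ~~ D d ->
  a != b -> c != d -> N (tperm a b * tperm c d).
Proof.
move=> sh Da Db Dc Dd ab cd; have [_ [_ [_ [_ _ _ _ /N1 N1']]]] := sh.
have share x y z : ~~ D x -> ~~ D y -> ~~ D z -> x != y -> x != z ->
    N (tperm x y * tperm x z).
  move=> Dx Dy Dz xy xz; case: (eqVneq y z) => [->|yz]; first by rewrite tperm2.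
  by apply: three_cycles; rewrite //= !inE negb_or xy xz yz.
case: (eqVneq a c) => [ac|ac]; first by rewrite -ac; apply: share; rewrite // ac.
have -> : tperm a b * tperm c d = (tperm a b * tperm a c) * (tperm c a * tperm c d).
  by rewrite [tperm c a]tpermC !mulgA -[_ * tperm a c * tperm a c]mulgA tperm2 mulg1.
by apply: N_M; apply: share; rewrite // eq_sym.
Qed.

(** A 3-cycle yields all even permutations off [D]; multiplying the odd [h] by a suitable one leaves
    a transposition. *)
Lemma three_cycle_transposition h : three_cycle -> N h -> odd_perm h ->
  exists a b, [/\ ~~ D a, ~~ D b, a != b & N (tperm a b)].
Proof.
move=> sh Nh oh; have [x [y [z [Dx Dy _ uxyz _]]]] := sh.
have xy : x != y by move: uxyz; rewrite /= !inE negb_or => /andP[/andP[]].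
have H g : fixes g -> if odd_perm g then N (g * tperm x y) else N g.
  move=> fg; have gD u : predC D (g u) = predC D u.
    by rewrite /= (fixes_stable _ fg).
  move: fg; elim/(@perm_supp_ind _ (predC D)): gD => {}g.
    move=> fW fD; have -> : g = 1.
      by apply/permP=> u; rewrite perm1; case: (boolP (D u)) => Du; [apply: fD|apply: fW].
    by rewrite odd_perm1; apply: N1 Nh.
  move=> u Du Dgu gu _; exists 1 => [|IH fg]; first by move=> ?; rewrite perm1.
  rewrite mulg1 in IH; set t := tperm (g u) u in IH.
  have tt : g * t * t = g by rewrite -mulgA tperm2 mulg1.
  have ft : fixes (g * t).
    move=> w Dw; rewrite permM fg // tpermD //; first by apply: contraNneq Dgu => ->.
    by apply: contraNneq Du => ->.
  move: (IH ft); rewrite odd_permM odd_tperm gu addbT.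
  case: (odd_perm g) => /= H1.
    rewrite -tt -mulgA; apply: N_M H1 _; exact: even_products.
  have -> : g = (g * t * tperm x y) * (tperm x y * t).
    by rewrite !mulgA -[_ * tperm x y * tperm x y]mulgA tperm2 mulg1 tt.
  by apply: N_M H1 _; apply: even_products.
have := H h (N_fix Nh); rewrite oh => Nhxy; exists x, y; split=> //.
by rewrite -[tperm x y]mul1g -(mulVg h) -mulgA; apply: N_M Nhxy; apply: N_V.
Qed.

(** Without 3-cycles, commutators show in turn that [h] is an involution, moves every point off [D],
    and that there are at most four such points. With two points [h] is a transposition; with four
    it would be even. *)
Lemma normal_transposition h : N h -> odd_perm h ->
  exists a b, [/\ ~~ D a, ~~ D b, a != b & N (tperm a b)].
Proof.
move=> Nh oh.
have [sh|nsh] : three_cycle \/ ~ three_cycle by apply: Classical_Prop.classic.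
  exact: three_cycle_transposition sh Nh oh.
have WN a : h a != a -> ~~ D a by apply: contra => /(N_fix Nh) ->.
have inv a : ~~ D a -> h (h a) = a.
  move=> Da; apply/eqP; apply/negP=> /negP hha; case: nsh.
  have ha : h a != a by apply: contraNneq hha => e; rewrite !e.
  exists (h a), (h (h a)), a; split=> //; rewrite ?N_D //.
    by rewrite /= !inE negb_or (inj_eq perm_inj) eq_sym ha hha.
  by rewrite [tperm (h a) a]tpermC; have := @N_comm h a (h a) Nh Da; rewrite N_D // => /(_ Da). 
have nofix a f : h a != a -> ~~ D f -> h f != f.
  move=> ha Df; apply/negP=> /eqP hf; case: nsh; have Da := WN _ ha.
  have fa : f != a by apply: contraNneq ha => <-; rewrite hf.
  have fha : f != h a by rewrite -hf (inj_eq perm_inj).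
  exists f, (h a), a; split; rewrite ?N_D //=.
    by rewrite !inE negb_or fha fa ha.
  by have := N_comm Nh Da Df; rewrite hf ![tperm f _]tpermC.
have [a ha] : exists a, h a != a.
  apply/existsP; apply: contraTT oh; rewrite negb_exists => /forallP h1.
  have -> : h = 1 by apply/permP=> x; rewrite perm1; apply/eqP; have := h1 x; rewrite negbK.
  by rewrite odd_perm1.
have Da := WN _ ha; have Dha : ~~ D (h a) by rewrite N_D.
case: (boolP [exists c, [&& ~~ D c, c != a & c != h a]]) => [|none]; last first.
  exists a, (h a); split; rewrite 1?eq_sym //.
  suff <- : h = tperm a (h a) by [].
  apply/permP=> x; case: tpermP => [->|->|/eqP xa /eqP xha] //; first by rewrite inv.
  case: (boolP (D x)) => [/(N_fix Nh) //|Dx].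
  by case/negP: none; apply/existsP; exists x; rewrite Dx xa xha.
case/existsP=> c /and3P[Dc ca cha]; have Dhc : ~~ D (h c) by rewrite N_D.
have hc := nofix _ _ ha Dc.
have hca : h c != a by apply: contraNneq cha => <-; rewrite inv.
have hcha : h c != h a by rewrite (inj_eq perm_inj).
(* For a fifth point [e], the commutator of [h] with [tperm a c] times the inverse of its conjugate
   by [tperm (h c) e] is a 3-cycle on [h a], [h c], [e]. *)
case: (boolP [exists e, [&& ~~ D e, e != a, e != h a, e != c & e != h c]]) => [|none].
  case/existsP=> e /and5P[De ea eha ec ehc]; case: nsh.
  have N_ac := N_comm Nh Da Dc.
  have [e1 e2 e3] : [/\ tperm (h c) e (h a) = h a, tperm (h c) e a = a & tperm (h c) e c = c].
    by split; apply: tpermD.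
  have := N_J N_ac Dhc De; rewrite conjMg !tpermJ tpermL e1 e2 e3.
  move/N_V; rewrite invMg !tpermV => /(N_M N_ac).
  rewrite -mulgA [tperm a c * _]mulgA tperm2 mul1g => Nbde.
  exists (h a), (h c), e; split; rewrite //= !inE negb_or ![h a == _]eq_sym hcha eha.
  by rewrite eq_sym ehc.
have : h = tperm a (h a) * tperm c (h c).
  apply/permP=> x; rewrite permM.
  case: (eqVneq x a) => [->|xa]; first by rewrite tpermL tpermD.
  case: (eqVneq x (h a)) => [->|xha]; first by rewrite tpermR tpermD ?inv.
  rewrite (tpermD (x := a)) 1?eq_sym //.
  case: tpermP => [->|->|/eqP xc /eqP xhc] //; first by rewrite inv.
  case: (boolP (D x)) => [/(N_fix Nh) //|Dx].
  by case/negP: none; apply/existsP; exists x; rewrite Dx xa xha xc xhc.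
by move=> eh; move: oh; rewrite eh odd_permM !odd_tperm ![_ == h _]eq_sym ha hc.
Qed.

End Normal.

(** * Weak exchanges and parity for two classes *)

Section TwoColours.

Variables (V P : finType) (X : sgraph V) (Y : sgraph P) (col : P -> bool).
Hypothesis Ycol : forall u v, Y u v = (col u != col v).
Implicit Types (s : bijection V P) (g h : {perm P}).
Local Notation inG := (inG X Y col).

(* The tokens of the other class may end up permuted, but by an odd permutation. *)
Definition weak_exch d s i j :=
  i = j \/ exists w, [/\ odd_perm w, fixes (fun u => col u == d) w
                       & inG s (tperm i j * w)%g].

Lemma weak_sym d s i j : weak_exch d s i j -> weak_exch d s j i.
Proof. by case=> [->|[w]]; [left|rewrite tpermC; right; exists w]. Qed.

(** One permutation is conjugated by the other, which keeps its correction odd; in a product the two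
    odd corrections would combine to an even one. *)
Lemma weak_trans d s i j k : col i == d -> col j == d -> col k == d ->
  weak_exch d s i j -> weak_exch d s j k -> weak_exch d s i k.
Proof.
move=> ci cj ck [-> //|[w1 [o1 f1 G1]]] [<-|[w2 [o2 f2 G2]]].
  by right; exists w1.
case: (eqVneq i k) => [->|ik]; first by left.
case: (eqVneq i j) => [->|ij]; first by right; exists w2.
case: (eqVneq j k) => [<-|jk]; first by right; exists w1.
right; have GJ := inGJ Ycol G2 G1; rewrite conjMg tpermJ in GJ.
have e1 : (tperm i j * w1)%g j = i by rewrite permM tpermR f1.
have e2 : (tperm i j * w1)%g k = k by rewrite permM tpermD ?f1.
rewrite e1 e2 in GJ; exists (w2 ^ (tperm i j * w1))%g; split=> //.
  by rewrite odd_permJ.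
move=> u cu; rewrite -[u](permKV (tperm i j * w1)%g) permJ f2 //.
by have [GVc _] := inGV Ycol G1; rewrite GVc.
Qed.

Lemma weak_move d s s' i j : connect (FS X Y) s s' -> weak_exch d s i j ->
  weak_exch d s' i j.
Proof.
move=> c [->|[w [ow fw Gw]]]; [by left|right; exists w; split=> //].
exact: inG_move Gw.
Qed.

Lemma weak_exchE d m v a b c : X v a -> X v b -> X v c -> uniq [:: a; b; c] ->
  2 <= m <= #|[set u | col u != d]| -> connected X -> ~ has_bridge X m ->
  forall s i j, col i = d -> col j = d -> weak_exch d s i j.
Proof.
move=> Xva Xvb Xvc abc m2 cX nbr s i j /eqP ci /eqP cj.
apply: (@growth _ _ X Y (fun u => col u == d) (class_adjacent Ycol (c0 := d)) (weak_exch d) _ _ _ _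
  v a b c Xva Xvb Xvc abc _ m m2 cX nbr s i j ci cj).
- by left.
- by move=> *; apply: weak_sym.
- by move=> s0 x y z bx by_ bz; apply: weak_trans.
- by move=> s0 s1 u w _ _ c01; apply: weak_move.
move=> s0 x y xS yS xy bx by_ wS.
have [s1 [k [l [i1 [j1 [c01 pl cl h]]]]]] := arrange Ycol Xva Xvb Xvc abc xS yS xy bx by_ wS.
right; exists (tperm k l).
rewrite (arranged_tperm xS yS xy bx by_ cl h pl).
have /and4P[/eqP bk /eqP bl /eqP bi /eqP bj] := cl.
have kl : k != l.
  have /= := claw_uniq Xva Xvb Xvc abc; rewrite !inE !negb_or -!andbA => /andP[va _].
  by case: pl => _ _ [<- <- _ _]; rewrite (inj_eq (@bijI _ _ s1)).
split; first by rewrite odd_tperm kl.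
  by move=> u /eqP cu; rewrite tpermD //; apply/eqP=> e; [case: bk|case: bl]; rewrite e.
apply: (inG_move Ycol (s := s1)); first by rewrite FSC.
apply: (claw_double Ycol Xva Xvb Xvc abc pl); rewrite ?bi ?bj //.
  have nd z : col z <> d -> col z = ~~ d by case: (col z); case: (d).
  by rewrite (nd k) // (nd l).
by apply/eqP=> e; case: bk.
Qed.

Section Parity.

Hypothesis cX : connected X.
Variable s : bijection V P.
Hypothesis both : exists i j, col i /\ ~~ col j.

(** [p] is the parity of a token permutation exchanging the colours on [a] and [b]; this permutation
    need not preserve colours. The notion is boolean because it later serves as a 2-colouring of
    [X]. *)
Definition swappable p a b := [forall s' : bijection V P, connect (FS X Y) s s' ==>
  (col (s' a) != col (s' b)) ==>
  [exists g : {perm P}, [&& connect (FS X Y) s' (pact g s'), odd_perm g == p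
    & [forall x, col (pact g s' x) == col (s' (tperm a b x))]]]].

Lemma swappableP p a b : reflect (forall s' : bijection V P, connect (FS X Y) s s' ->
  col (s' a) != col (s' b) -> exists g, [/\ connect (FS X Y) s' (pact g s'),
    odd_perm g = p & forall x, col (pact g s' x) = col (s' (tperm a b x))])
  (swappable p a b).
Proof.
apply: (iffP forallP) => H s'.
  move=> c ne; have := H s'; rewrite c ne /= => /existsP[g /and3P[cg /eqP og /forallP cs]].
  by exists g; split=> // x; apply/eqP.
apply/implyP=> c; apply/implyP=> ne; have [g [cg og cs]] := H s' c ne.
by apply/existsP; exists g; rewrite cg og eqxx; apply/forallP=> x; rewrite cs.
Qed.

Lemma swappable_edge a b : X a b -> swappable true a b.
Proof.
move=> Xab; apply/swappableP=> s' _ ne; exists (tperm (s' a) (s' b)); split.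
- by apply: (connect_sw (s := s')); rewrite // Ycol.
- by rewrite odd_tperm; apply: contraNneq ne => ->.
- by move=> x; rewrite -[pact _ _]/(sw a b s') swE.
Qed.

(** Whichever of the two exchanges has ends of different colours is made first; after it the ends of
    the other differ as well. *)
Lemma swappable_trans p q a b c : uniq [:: a; b; c] ->
  swappable p a b -> swappable q b c -> swappable (p (+) q) a c.
Proof.
rewrite /= !inE negb_or andbT => /andP[/andP[ab ac] bc] /swappableP Sab /swappableP Sbc.
apply/swappableP=> s' cs' ne.
have tab x : tperm a b x = if x == a then b else if x == b then a else x by rewrite permE.
have tbc x : tperm b c x = if x == b then c else if x == c then b else x by rewrite permE.
have tac x : tperm a c x = if x == a then c else if x == c then a else x by rewrite permE.
case: (eqVneq (col (s' b)) (col (s' a))) => [eba|nba].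
  have [|g1 [c1 o1 e1]] := Sbc s' cs'; first by rewrite eba.
  have [||g2 [c2 o2 e2]] := Sab (pact g1 s'); first exact: connect_trans c1.
    by rewrite !e1 !tbc eqxx (negbTE ab) (negbTE ac).
  exists (g1 * g2)%g; rewrite pactM; split; first exact: connect_trans c2.
    by rewrite odd_permM o1 o2 addbC.
  move=> x; rewrite e2 e1 tab tbc tac.
  case xa: (x == a); first by rewrite eqxx.
  case xb: (x == b); first by rewrite (eqP xb) (negbTE ab) (negbTE ac) (negbTE bc) eba.
  by rewrite xb; case: (x == c); rewrite ?eba.
have ebc : col (s' b) = col (s' c).
  by move: ne nba; case: (col (s' a)); case: (col (s' b)); case: (col (s' c)).
have [|g1 [c1 o1 e1]] := Sab s' cs'; first by rewrite eq_sym.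
have [||g2 [c2 o2 e2]] := Sbc (pact g1 s'); first exact: connect_trans c1.
  by rewrite !e1 !tab eqxx ![_ == a]eq_sym (negbTE ab) (negbTE ac) [c == b]eq_sym (negbTE bc).
exists (g1 * g2)%g; rewrite pactM; split; first exact: connect_trans c2.
  by rewrite odd_permM o1 o2.
move=> x; rewrite e2 e1 tab tbc tac.
case xa: (x == a).
  by rewrite (eqP xa) (negbTE ab) (negbTE ac) eqxx ebc.
case xb: (x == b).
  by rewrite (eqP xb) ![c == _]eq_sym (negbTE ac) (negbTE bc) ebc.
by case xc: (x == c); rewrite ?xa ?xb ?eqxx // eq_sym (negbTE ab).
Qed.

Lemma differ a b : a != b ->
  exists2 s' : bijection V P, connect (FS X Y) s s' & col (s' a) != col (s' b).
Proof.
move=> ab; case: (eqVneq (col (s a)) (col (s b))) => [eab|]; last by exists s.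
have [z nz] : exists z, col (s z) != col (s b).
  have [i [j [ci cj]]] := both; case cb: (col (s b)).
    by exists (bij_inv s j); rewrite bij_invK (negbTE cj).
  by exists (bij_inv s i); rewrite bij_invK ci.
have Yc u w : col u != col w -> Y u w by rewrite Ycol.
have caz : connect (inside X setT) a z.
  by apply: connect_sub (cX a z) => x y Xxy; apply: connect1; rewrite /inside Xxy !inE.
have [s1 [c1 _] e1] := recolor Yc s caz; exists s1 => //.
rewrite !e1 tpermL tpermD //.
by apply: contraNneq nz => ->.
Qed.

(** If every return were even, the parity of an exchange between two vertices would be unique, and
    the parities of exchanges with a root [r] would 2-colour [X]. *)
Lemma odd_return : ~ bipartite X -> exists g, inG s g /\ odd_perm g.
Proof.
move=> nbip; suff /existsP[g /and3P[/forallP gc cg og]] : [exists g : {perm P},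
    [&& [forall u, col (g u) == col u], connect (FS X Y) s (pact g s) & odd_perm g]].
  by exists g; split=> //; split=> // u; apply/eqP.
apply: contraT => noodd; case: nbip.
have even g : inG s g -> odd_perm g = false.
  move=> [gc cg]; apply: contraNF noodd => og; apply/existsP; exists g.
  by apply/and3P; split=> //; apply/forallP=> u; rewrite gc.
have consistent p q a b : a != b -> swappable p a b -> swappable q a b -> p = q.
  move=> ab /swappableP Sp /swappableP Sq; have [s' cs ne] := differ ab.
  have [g1 [c1 o1 e1]] := Sp s' cs ne; have [g2 [c2 o2 e2]] := Sq s' cs ne.
  (* Two exchanges of the same pair lead to the same colour pattern, so they differ by a return. *)
  have : inG (pact g1 s') (g1^-1 * g2)%g.
    split=> [u|]; last first.
      rewrite -pactM mulgA mulgV mul1g; apply: connect_trans c2; by rewrite FSC.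
    rewrite permM -[in RHS](permKV g1 u) -[(g1^-1 u)%g](bij_invK s') -!pactE e1 e2 //.
  move/(inG_move Ycol (s' := s)) => /(_ _) G.
  have {G} : inG s (g1^-1 * g2)%g by apply: G; rewrite FSC; apply: connect_trans c1.
  by move/even; rewrite odd_permM odd_permV o1 o2; case: (p); case: (q).
have [i _] := both; pose r := bij_inv s i.
have reach_r x : x = r \/ exists p, swappable p r x.
  case/connectP: (cX r x) => l; elim/last_ind: l x => [|l y IH] x; first by move=> _ ->; left.
  rewrite rcons_path last_rcons => /andP[pl Xy] ->.
  case: (eqVneq y r) => [|yr]; first by left.
  right; case: (IH _ pl erefl) => [lr|[p Sp]].
    by exists true; apply: swappable_edge; rewrite lr in Xy.
  case: (eqVneq (last r l) r) => [lr|lr].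
    by exists true; apply: swappable_edge; rewrite lr in Xy.
  exists (p (+) true); apply: swappable_trans Sp (swappable_edge Xy).
  rewrite /= !inE negb_or ![r == _]eq_sym lr yr /= andbT.
  by apply: contraTneq Xy => ->; rewrite edge_irr.
exists (fun x => (x != r) && swappable true r x) => u w Xuw.
case: (eqVneq u r) => [ur|ur] /=.
  have wr : w != r by apply: contraTneq Xuw => ->; rewrite ur edge_irr.
  by rewrite wr /=; rewrite ur in Xuw; rewrite swappable_edge.
case: (eqVneq w r) => [wr|wr] /=.
  by rewrite edge_sym wr in Xuw; rewrite swappable_edge.
have [//|[p Sp]] := reach_r u; first by move/eqP: ur.
have Sw : swappable (p (+) true) r w.
  apply: swappable_trans Sp (swappable_edge Xuw).
  rewrite /= !inE negb_or ![r == _]eq_sym ur wr /= andbT.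
  by apply: contraTneq Xuw => ->; rewrite edge_irr.
have val p0 x : x != r -> swappable p0 r x -> swappable true r x = p0.
  move=> xr S0; apply/idP/idP=> [S1|p1]; last by rewrite -p1.
  by rewrite (consistent p0 true r x) // eq_sym.
by rewrite (val _ _ ur Sp) (val _ _ wr Sw); case: (p).
Qed.

End Parity.

(** Let [N] be the attainable permutations fixing the class of [i] pointwise. Weak exchanges in the
    other class make [N] normal, and an odd return corrected on the class of [i] makes it contain an
    odd element. Hence [N] holds all permutations of the other class, and the correction in the weak
    exchange of [i] and [j] can be undone. *)
Lemma two_colours m v a b c s i j : X v a -> X v b -> X v c -> uniq [:: a; b; c] ->
  2 <= m <= #|[set u | col u]| -> m <= #|[set u | ~~ col u]| ->
  connected X -> ~ bipartite X -> ~ has_bridge X m ->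
  col i = col j -> inG s (tperm i j).
Proof.
move=> Xva Xvb Xvc abc /andP[m2 mt] mf cX nbip nbr cij.
have WE d : forall i j, col i = d -> col j = d -> weak_exch d s i j.
  move=> i0 j0; apply: (weak_exchE Xva Xvb Xvc abc _ cX nbr); rewrite m2 /=.
  case: d; first by rewrite (eq_card (B := [set u | ~~ col u])) // => u; rewrite !inE eqb_id.
  by rewrite (eq_card (B := [set u | col u])) // => u; rewrite !inE eqbF_neg negbK.
have both : exists i j, col i /\ ~~ col j.
  have /card_gt0P[x] : 0 < #|[set u | col u]| by apply: leq_trans mt; apply: ltnW.
  have /card_gt0P[y] : 0 < #|[set u | ~~ col u]| by apply: leq_trans mf; apply: ltnW.
  by rewrite !inE => cy cx; exists x, y.
pose d := col i; pose D : pred P := fun u => col u == d.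
have ND u : ~~ D u -> col u = ~~ d by rewrite /D; case: (col u); case: (d).
pose N g := inG s g /\ fixes D g.
have N_M g h : N g -> N h -> N (g * h)%g.
  move=> [Gg fg] [Gh fh]; split; first exact: inGM.
  by move=> u Du; rewrite permM fg ?fh.
have N_V g : N g -> N g^-1%g.
  move=> [Gg fg]; split; first exact: inGV.
  by move=> u Du; apply: (@perm_inj _ g); rewrite permKV fg.
have N_fix g : N g -> fixes D g by case.
have N_J g x y : N g -> ~~ D x -> ~~ D y -> N (g ^ tperm x y)%g.
  move=> [Gg fg] Dx Dy; case: (WE (~~ d) x y (ND _ Dx) (ND _ Dy)) => [->|[w [_ fw Gw]]].
    by rewrite tperm1 conjg1.
  have fJ : fixes D (g ^ tperm x y)%g.
    move=> u Du; have tu : tperm x y u = u.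
      by apply: tpermD; [apply: contraNneq Dx|apply: contraNneq Dy] => ->.
    by rewrite -{1}tu permJ fg.
  split=> //; have := inGJ Ycol Gg Gw; rewrite conjgM.
  (* [w] moves only points of [D], all fixed by [g ^ tperm x y], so the two commute. *)
  suff -> : ((g ^ tperm x y) ^ w)%g = (g ^ tperm x y)%g by [].
  apply/permP=> u; rewrite -[u](permKV w) permJ; set z := (w^-1 u)%g.
  have fW y0 : ~~ D y0 -> w y0 = y0 by move/ND => cy; apply: fw; rewrite cy.
  have hD y0 : D ((g ^ tperm x y)%g y0) -> D y0.
    by move=> Dh; have /perm_inj e := fJ _ Dh; rewrite e in Dh.
  case: (boolP (D z)) => Dz.
    have Dwz : D (w z) by apply: contraT => nD; have /perm_inj e := fW _ nD; rewrite e Dz in nD.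
    by rewrite !fJ.
  by rewrite [w z]fW // fW //; apply: contra Dz; apply: hD.
have [g [Gg og]] := odd_return cX s both nbip.
(* Each correction is a product of the odd factors [tperm (g u) u] and [w], so the parity of [g] is
   kept. *)
have [h Nh oh] : exists2 h, N h & odd_perm h.
  have [gc _] := Gg; move: Gg og.
  have gD u : D (g u) = D u by rewrite /D gc.
  elim/(@perm_supp_ind _ D): gD => {gc}g.
    by move=> fg Gg og; exists g.
  move=> u Du Dgu gu _; have [e|[w [ow fw Gw]]] := WE d (g u) u (eqP Dgu) (eqP Du).
    by rewrite e eqxx in gu.
  exists w => // IH Gg og.
  apply: IH; first exact: inGM.
  by rewrite odd_permM odd_permM odd_tperm gu ow og.
have [x [y [Dx Dy xy Nxy]]] := normal_transposition N_M N_V N_fix N_J Nh oh.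
have Nall x' y' : ~~ D x' -> ~~ D y' -> x' != y' -> N (tperm x' y').
  move=> Dx' Dy' xy'; have := N_J _ _ _ Nxy Dx Dx'; rewrite tpermJ tpermL.
  have Dz : ~~ D (tperm x x' y) by case: tpermP.
  have : x' != tperm x x' y by rewrite -{1}(tpermL x x') (inj_eq perm_inj).
  move: (tperm x x' y) Dz => z Dz xz Nxz; have := N_J _ _ _ Nxz Dz Dy'.
  by rewrite tpermJ tpermL [tperm z y' x']tpermD // eq_sym.
have Nfix w : fixes D w -> inG s w.
  move=> fw; have wW u : predC D (w u) = predC D u by rewrite /= (fixes_stable _ fw).
  move: fw; elim/(@perm_supp_ind _ (predC D)): wW => {}w.
    move=> fW fD; have -> : w = 1%g; last exact: inG1.
    by apply/permP=> u; rewrite perm1; case: (boolP (D u)) => Du; [apply: fD|apply: fW].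
  move=> u Du Dwu wu _; exists 1%g => [|IH fw]; first by move=> ?; rewrite perm1.
  rewrite mulg1 in IH; have -> : w = (w * tperm (w u) u * tperm (w u) u)%g.
    by rewrite -mulgA tperm2 mulg1.
  apply: (inGM Ycol); last by case: (Nall _ _ Dwu Du wu).
  apply: IH => z Dz; rewrite permM (fw z) // tpermD //.
    by apply: contraNneq Dwu => ->.
  by apply: contraNneq Du => ->.
case: (WE d i j erefl (esym cij)) => [->|[w [_ fw Gw]]].
  by rewrite tperm1; apply: inG1.
by rewrite -[tperm i j](mulgK w); apply: (inGM Ycol) Gw _; apply: (inGV Ycol); apply: Nfix.
Qed.

End TwoColours.

(** * Vertices of degree three *)

Section Degrees.

Variables (V : finType) (X : sgraph V).
Hypothesis cX : connected X.

Lemma next2_neq (s : seq V) u : uniq s -> 2 < size s -> u \in s -> next s (next s u) != u.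
Proof.
move=> us s3 uin; have [i s' es] := rot_to uin.
rewrite -!(next_rot i us); have := us; rewrite -(rot_uniq i).
have : 2 < size (rot i s) by rewrite size_rot.
rewrite es; case: s' {es} => // x [//|y r] _ /=; rewrite !inE !negb_or eqxx -!andbA.
by case/and5P=> ux uy _ _ _; rewrite [x == u]eq_sym (negbTE ux) eqxx eq_sym.
Qed.

(** Both neighbours of a vertex on the cycle lie on it already, so connectedness makes the cycle the
    whole graph. *)
Lemma cycle_of_deg_le2 s : (forall v, deg X v <= 2) -> 2 < size s -> ucycle X s ->
  is_cycle X.
Proof.
move=> d2 s3 /andP[cs us].
have nbr u w : u \in s -> X u w -> w = next s u \/ w = prev s u.
  move=> uin Xuw; have Xn : X u (next s u) by apply: next_cycle.
  have Xp : X u (prev s u) by rewrite edge_sym; apply: prev_cycle.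
  have np : next s u != prev s u.
    apply: contraNneq (next2_neq us s3 uin) => ->; by rewrite next_prev.
  case: (eqVneq w (next s u)) => [->|wn]; first by left.
  case: (eqVneq w (prev s u)) => [->|wp]; first by right.
  have := d2 u; rewrite leqNgt => /negP[]; rewrite /deg.
  have <- : #|[set w; next s u; prev s u]| = 3.
    by rewrite -setUA cardsU1 cards2 !inE negb_or wn wp np.
  by apply/subset_leq_card/subsetP=> x; rewrite !inE => /orP[/orP[]|]/eqP ->.
have all_s v : v \in s.
  case: s {d2 cs} s3 us nbr => // u s' _ us nbr.
  case/connectP: (cX u v) => p; have : u \in u :: s' by rewrite inE eqxx.
  elim: p {1 3 4}u => [|y p IH] x xs /=; first by move=> _ ->.
  case/andP=> Xxy; apply: IH; have [->|->] := nbr x y xs Xxy; by rewrite ?mem_next ?mem_prev.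
exists s; split=> // u v; apply/idP/orP=> [Xuv|[]/eqP ->].
- have [->|->] := nbr u v (all_s u) Xuv; first by left.
  by right; rewrite next_prev.
- exact: next_cycle.
- by rewrite edge_sym; apply: next_cycle.
Qed.

(** A new vertex has only one neighbour in the connected set coloured so far, since a second would
    close a cycle; it takes the opposite colour. *)
Lemma acyclic_bipartite : acyclic X -> bipartite X.
Proof.
move=> aX; case: (pickP V) => [r _|V0]; last by exists (fun _ => true) => u; have := V0 u.
suff H n (T : {set V}) (c : V -> bool) : #|~: T| < n -> r \in T -> conn X T ->
    {in T &, forall u v, X u v -> c u != c v} -> bipartite X.
  apply: (H _ [set r] (fun _ => true) (ltnSn _)); first by rewrite inE.
    by move=> x y; rewrite !inE => /eqP -> /eqP ->.
  by move=> x y; rewrite !inE => /eqP -> /eqP ->; rewrite edge_irr.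
elim: n T c => // n IH T c Tn rT cT pc.
case: (set_0Vmem (~: T)) => [T0|[u0]].
  have inT x : x \in T by have /setP/(_ x) := T0; rewrite !inE => /negbFE.
  by exists c => x y; apply: pc.
rewrite inE => u0T; have [u [v [uT vT Xuv _]]] := first_hit cX u0T rT.
have only w : w \in T -> X u w -> w = v.
  move=> wT Xuw; apply/eqP; apply/negP=> /negP wv.
  case/connectP: (cT v w vT wT) => p0 pp0 ew; case: (shortenP pp0) ew => p pp up _ ew {p0 pp0}.
  apply: (aX (u :: v :: p)); first by case: p ew {pp up} => //= ew; rewrite ew eqxx in wv.
  have pX : path X v p by apply: sub_path pp => x y /and3P[].
  have pT : {subset p <= T}.
    move: pp {up pX ew}; elim: p {vT Xuv wv} v => // y p IHp x /= /andP[/and3P[_ _ yT] pp] z.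
    by case/predU1P=> [->//|]; apply: IHp pp z.
  apply/andP; split; first by rewrite /= rcons_path Xuv pX /= -ew edge_sym.
  rewrite cons_uniq up andbT inE negb_or; apply/andP; split.
    by apply: contraNneq uT => ->.
  by apply: contra uT => /pT.
apply: (IH (u |: T) (fun x => if x == u then ~~ c v else c x)).
- rewrite ltnS in Tn; apply: leq_trans Tn; apply: proper_card; rewrite properC.
  by rewrite properUr // sub1set.
- by rewrite inE rT orbT.
- by apply: (@conn_add _ _ _ v); rewrite // edge_sym.
have uT' x : x \in T -> (x == u) = false by move=> xT; apply: contraNF uT => /eqP <-.
move=> x y /setU1P[->|xT] /setU1P[->|yT]; rewrite ?eqxx ?edge_irr //.
- by move=> Xuy; rewrite uT' // (only _ yT Xuy); case: (c v).
- by rewrite edge_sym => Xux; rewrite uT' // (only _ xT Xux); case: (c v).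
by rewrite !uT' //; apply: pc.
Qed.

Lemma claw_exists : ~ is_cycle X -> ~ is_tree X \/ ~ bipartite X ->
  exists v a b c, [/\ X v a, X v b, X v c & uniq [:: a; b; c]].
Proof.
move=> ncyc ntree; suff /existsP[v] : [exists v, 2 < deg X v].
  case/card_gt2P=> a [b [c [[]]]]; rewrite !inE => Xa Xb Xc [ab bc ca].
  by exists v, a, b, c; split=> //=; rewrite !inE negb_or ab bc eq_sym ca.
apply: contraT; rewrite negb_exists => /forallP d2.
have aX : acyclic X.
  move=> s s3 cs; apply: ncyc; apply: cycle_of_deg_le2 cs => // v.
  by rewrite leqNgt.
by case: ntree => [[]|[]]; [split|apply: acyclic_bipartite].
Qed.

End Degrees.

(** * Assembling the cases *)

Lemma tperm_trans (P : finType) (H : {perm P} -> Prop) (u v w : P) :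
  H 1%g -> (forall g h, H g -> H h -> H (g ^ h)%g) ->
  H (tperm u v) -> H (tperm v w) -> H (tperm u w).
Proof.
move=> H1 HJ Huv Hvw.
case: (eqVneq u w) => [->|uw]; first by rewrite tperm1.
case: (eqVneq v w) => [<- //|vw].
by have := HJ _ _ Hvw Huv; rewrite tpermJ tpermR tpermD.
Qed.

Lemma many_colours (V P : finType) (X : sgraph V) (Y : sgraph P) (C : eqType)
    (col : P -> C) m v a b c s i j :
  (forall u v, Y u v = (col u != col v)) ->
  X v a -> X v b -> X v c -> uniq [:: a; b; c] ->
  connected X -> ~ has_bridge X m -> 2 <= m <= #|[set u | col u != col i]| ->
  (forall c1, exists z, col z != col i /\ col z != c1) ->
  col i = col j -> inG X Y col s (tperm i j).
Proof.
move=> Ycol Xva Xvb Xvc abc cX nbr m2 c3 cij.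
apply: (@growth _ _ X Y (fun u => col u == col i) (class_adjacent Ycol (c0 := col i))
  (fun s u w => inG X Y col s (tperm u w)) _ _ _ _ v a b c Xva Xvb Xvc abc _ m m2 cX nbr s i j).
- by move=> s0 u; rewrite tperm1; apply: inG1.
- by move=> s0 u w _ _; rewrite tpermC.
- move=> s0 u w z _ _ _; apply: tperm_trans; first exact: inG1.
  by move=> g h; apply: inGJ.
- by move=> s0 s1 u w _ _ c01; apply: inG_move.
- move=> s0 x y; exact: three_colours.
- exact: eqxx.
- by rewrite cij.
Qed.

Lemma path_leq_last x (l : seq nat) y : path leq x l -> y \in x :: l -> y <= last x l.
Proof.
elim: l x y => [|z l IH] x y /=; first by rewrite inE => _ /eqP ->.
case/andP=> xz pl; rewrite inE => /orP[/eqP ->|]; last exact: IH.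
by apply: leq_trans xz _; apply: IH; rewrite ?inE ?eqxx.
Qed.

Lemma size_leq_sumn (l : seq nat) : all (leq 1) l -> size l <= sumn l.
Proof. by elim: l => //= x l IH /andP[x1 /IH]; lia. Qed.

Theorem theorem3p1 (t n : nat) (k : t.-tuple nat)
    (K : sgraph 'I_n) (V : finType) (X : sgraph V) :
  2 <= t ->
  path leq 1 k ->
  n = sumn k ->
  4 <= n ->
  complete_multipartite K k ->
  #|V| = n ->
  [/\ t = 2, last 0 k < n - 1 &
      [/\ connected X, ~ bipartite X, ~ is_cycle X
        & ~ has_bridge X (head 0 k)]] \/
  (2 < t /\
      [/\ connected X, ~ is_cycle X, ~ is_tree X
        & ~ has_bridge X (n - last 0 k)]) ->
  forall (i j : 'I_n) (s : bijection V 'I_n),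
    X (bij_inv s i) (bij_inv s j) ->
    exchangeable X K s i j.
Proof.
move=> t2 pk nk n4 [c [ck Kc]] _ hyp i j s Xij.
rewrite /exchangeable transpose_pact.
case: (boolP (K i j)) => [Kij|].
  have := @connect_sw _ _ X K _ _ s Xij; rewrite !bij_invK => /(_ Kij).
  by rewrite /sw !bij_invK.
rewrite Kc negbK => /eqP cij.
have k1 d : 1 <= tnth k d.
  by have /allP := order_path_min leq_trans pk; apply; apply: mem_tnth.
have kl d : tnth k d <= last 0 k.
  have e : last 0 k = last 1 k by case: (tval k) (size_tuple k) => //= e; rewrite -e in t2.
  by rewrite e; apply: path_leq_last pk _; rewrite inE mem_tnth orbT.
case: hyp => [[et kn [cX nbip ncyc nbr]]|[t3 [cX ncyc ntree nbr]]].
  have [v [a [b [d [Xa Xb Xd abd]]]]] := claw_exists cX ncyc (or_intror nbip).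
  subst t; case: k pk nk ck kn nbr {k1 kl} => [[|k0 [|k1 [|? ?]]] sk] //= pk nk ck kn nbr.
  have c2 (d0 : 'I_2) : d0 = ord0 \/ d0 = lift ord0 ord0.
    by case: d0 => [[|[|?]] lt] //; [left|right]; apply: val_inj.
  have Kcol u w : K u w = ((c u == ord0) != (c w == ord0)).
    by rewrite Kc; have [->|->] := c2 (c u); have [->|->] := c2 (c w).
  have e0 : #|[set u | c u == ord0]| = k0 by rewrite ck (tnth_nth 0).
  have e1 : #|[set u | c u != ord0]| = k1.
    have := ck (lift ord0 ord0); rewrite (tnth_nth 0) /= => <-; apply: eq_card => u; rewrite !inE.
    by have [->|->] := c2 (c u).
  have [_] : inG X K (fun u => c u == ord0) s (tperm i j); last by [].
  (* The bound [k1 < k0 + k1 - 1] gives [2 <= k0], and the ordering of [k] gives [k0 <= k1]. *)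
  apply: (two_colours Kcol (m := k0) s Xa Xb Xd abd _ _ cX nbip nbr) => //.
  - rewrite e0 leqnn andbT; lia.
  - by rewrite e1; lia.
  - by rewrite cij.
have [v [a [b [d [Xa Xb Xd abd]]]]] := claw_exists cX ncyc (or_introl ntree).
have [_] : inG X K c s (tperm i j); last by [].
apply: (many_colours s Kc Xa Xb Xd abd cX nbr _ _ cij) => //.
  have -> : #|[set u | c u != c i]| = n - tnth k (c i).
    have := cardsC [set u | c u == c i]; rewrite ck card_ord => e.
    by rewrite -[X in X - _]e addKn; apply: eq_card => u; rewrite !inE.
  (* The remaining bound [2 <= n - last 0 k] holds because at least two classes precede the last
     one, each of size at least 1. *)
  rewrite leq_sub2l // andbT.
  have := size_tuple k; have /allP pk1 := order_path_min leq_trans pk.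
  rewrite nk; case: (lastP k) pk1 => [|l x] pk1 sl; first by rewrite -sl in t2.
  rewrite last_rcons sumn_rcons addnK; rewrite size_rcons in sl.
  apply: (@leq_trans (size l)); first by rewrite -ltnS sl.
  by apply: size_leq_sumn; apply/allP=> y yl; apply: pk1; rewrite mem_rcons inE yl orbT.
move=> c1; have [d0 d0P] : exists d0, d0 \notin [set c i; c1].
  apply/existsP; apply: contraLR t3; rewrite negb_exists -leqNgt => /forallP h.
  rewrite -[t]card_ord -cardsT; apply: leq_trans (subset_leq_card _) (_ : #|[set c i; c1]| <= 2).
    by apply/subsetP=> x _; have := h x; rewrite negbK.
  by rewrite cards2; case: (_ != _).
have /card_gt0P[z] : 0 < #|[set u | c u == d0]| by rewrite ck.
rewrite inE => /eqP ez; exists z; rewrite ez.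
by move: d0P; rewrite !inE negb_or => /andP[].
Qed.
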